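(* Let $X=\{\Phi_{p_1,\theta_1}>0\}\cap\cdots\cap\{\Phi_{p_k,\theta_k}>0\}$ be the intersection of finitely many pairwise distinct open polynomial half planes. Then $X$ is a disjoint union of finitely many regions of type II.
   Context: For a real polynomial $p$ and angle $\theta$, $\Phi_{p,\theta}(x,y)=p(x\cos\theta+y\sin\theta)-(-x\sin\theta+y\cos\theta)$; $\{\Phi_{p,\theta}>0\}$ is an open polynomial half plane and $\{\Phi_{p,\theta}=0\}$ a rotated polynomial graph. A region of type I is a closed, connected, simply connected subset of $\mathbb{R}^2$ which is the closure of its interior and whose boundary is the union of finitely many arcs (sides), each contained in a rotated polynomial graph. A region of type II is the interior of a region of type I. *)

(* Defs.v *)
From HB Require Import structures.
From mathcomp Require Import all_boot all_order all_algebra.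
From mathcomp Require Import all_classical all_reals all_analysis.
Set Implicit Arguments. Unset Strict Implicit. Unset Printing Implicit Defensive.
Import Order.TTheory GRing.Theory Num.Theory.
Import numFieldNormedType.Exports.
Local Open Scope classical_set_scope.
Local Open Scope ring_scope.

Section Defs.
Variable R : realType.

Definition Phi (p : {poly R}) (t : R) (z : R * R) : R :=
  p.[z.1 * cos t + z.2 * sin t] - (- z.1 * sin t + z.2 * cos t).

Definition poly_half_plane (p : {poly R}) (t : R) : set (R * R) :=
  [set z | 0 < Phi p t z].

Definition rot_poly_graph (p : {poly R}) (t : R) : set (R * R) :=
  [set z | Phi p t z = 0].

Definition is_arc (A : set (R * R)) : Prop :=
  exists (I : set R) (g : R -> R * R),
    is_interval I /\ (exists a b, I a /\ I b /\ a < b) /\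
    {within I, continuous g} /\ {in I &, injective g} /\ A = g @` I.

Definition is_side (A : set (R * R)) : Prop :=
  is_arc A /\ exists (p : {poly R}) (t : R), A `<=` rot_poly_graph p t.

Definition unit_itv : set R := [set s | 0 <= s <= 1].

Definition path_connected (S : set (R * R)) : Prop :=
  forall x y, S x -> S y ->
    exists g : R -> R * R, {within unit_itv, continuous g} /\
      g 0 = x /\ g 1 = y /\ g @` unit_itv `<=` S.

Definition loops_contractible (S : set (R * R)) : Prop :=
  forall g : R -> R * R, {within unit_itv, continuous g} ->
    g @` unit_itv `<=` S -> g 0 = g 1 ->
    exists H : R * R -> R * R,
      {within unit_itv `*` unit_itv, continuous H} /\
      H @` (unit_itv `*` unit_itv) `<=` S /\
      (forall s, unit_itv s -> H (s, 0) = g s /\ H (s, 1) = g 0) /\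
      (forall u, unit_itv u -> H (0, u) = g 0 /\ H (1, u) = g 0).

Definition simply_connected (S : set (R * R)) : Prop :=
  path_connected S /\ loops_contractible S.

Definition boundary (S : set (R * R)) : set (R * R) :=
  closure S `\` interior S.

Definition region_typeI (S : set (R * R)) : Prop :=
  closed S /\ connected S /\ simply_connected S /\
  closure (interior S) = S /\
  exists (n : nat) (A : nat -> set (R * R)),
    (forall i, (i < n)%N -> is_side (A i)) /\
    boundary S = \bigcup_(i in `I_n) A i.

Definition region_typeII (S : set (R * R)) : Prop :=
  exists T, region_typeI T /\ S = interior T.

End Defs.

(* Main.v *)
Require Import Defs.
From HB Require Import structures.
From mathcomp Require Import all_boot all_order all_algebra.
From mathcomp Require Import all_classical all_reals all_analysis.
From mathcomp Require Import ring lra.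
From mathcomp Require polyorder polyrcf.
Import Order.TTheory GRing.Theory Num.Theory.
Import numFieldNormedType.Exports.
Set Implicit Arguments. Unset Strict Implicit. Unset Printing Implicit Defensive.
Local Open Scope classical_set_scope.
Local Open Scope ring_scope.

(** The regions are the interiors of the connected components of the closure
    of [X].  Cutting the plane along finitely many vertical lines (through the
    critical points of the abscissa on each curve and the crossings of distinct
    curves), the closure of [X] becomes a finite union of closed bands
    [a <= x <= b], [f x <= y <= g x], ordered from left to right and, within a
    strip, from bottom to top.  Bands are added in this order, and it is shown
    that a new band meets each component built so far in a vertical segment or
    not at all; gluing along vertical segments preserves the existence of
    strong deformation retractions onto every vertical segment, in particular
    onto every point, which gives simple connectedness.  No cycle can
    arise because, from a point where some [Phi] is nonpositive, [Phi]
    decreases along a straight ray to infinity: the ray avoids the closure of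
    [X], and if it goes to the left it separates the two places where a cycle
    would have to close up, while in any other direction it would run into the
    new band. *)

(** * Strong deformation retractions in the plane *)

(** Three difficulties shape the argument. First, the regions must be interiors: a component [T] of
    the closure has to have [T] intersected with [X] as its interior. This rests on [X] being the
    interior of the union of the closed bands, which again comes from the normal direction
    [(- sin t, cos t)], along which each [Phi] decreases at unit rate. Secondly, retractions onto
    points alone would not survive the gluing: a new band may be attached along a segment that
    straddles several earlier bands, so every vertical segment has to be a possible target. Thirdly,
    the vertical cuts are artefacts. A cut may run through [X] or meet the complement in single
    points, so an end of a band may be listed as a side only when it avoids [X] and is not a single
    point; it must then be shown that no boundary point is lost. *)

Lemma within_comp (T U V : topologicalType) (A : set T) (B : set U)
    (f : T -> U) (g : U -> V) :
  f @` A `<=` B -> {within A, continuous f} -> {within B, continuous g} ->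
  {within A, continuous (g \o f)}.
Proof.
move=> fAB /subspace_continuousP cf /subspace_continuousP cg.
apply/subspace_continuousP => x Ax.
have Bfx : B (f x) by apply: fAB; exists x.
apply: cvg_comp (cg _ Bfx) => P.
rewrite /within /= => nP.
have := cf _ Ax _ nP; rewrite /nbhs /= /within /=.
apply: filterS => y Py Ay; apply: Py => //.
by apply: fAB; exists y.
Qed.

Lemma within_pair (T U V : topologicalType) (A : set T)
    (f : T -> U) (g : T -> V) :
  {within A, continuous f} -> {within A, continuous g} ->
  {within A, continuous (fun x => (f x, g x))}.
Proof. by move=> cf cg x; apply: cvg_pair; [exact: cf|exact: cg]. Qed.

Lemma within_eq (T U : topologicalType) (A : set T) (f g : T -> U) :
  (forall x, A x -> f x = g x) ->
  {within A, continuous f} -> {within A, continuous g}.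
Proof.
by move=> fg; apply: subspace_eq_continuous => x; rewrite inE; exact: fg.
Qed.

Lemma closed_preimage (T U : topologicalType) (f : T -> U) (D : set U) :
  continuous f -> closed D -> closed (f @^-1` D).
Proof. by move=> cf cD; apply: preimage_closed => // x _; exact: cf. Qed.

(** * Pointwise operations on continuous real functions *)

Section Continuity.
Variables (R : realType) (T : topologicalType).
Implicit Types f g : T -> R.

Lemma continuousD' f g : continuous f -> continuous g ->
  continuous (fun x => f x + g x).
Proof. by move=> cf cg x; apply: cvgD; [exact: cf|exact: cg]. Qed.

Lemma continuousB' f g : continuous f -> continuous g ->
  continuous (fun x => f x - g x).
Proof. by move=> cf cg x; apply: cvgB; [exact: cf|exact: cg]. Qed.

Lemma continuousM' f g : continuous f -> continuous g ->
  continuous (fun x => f x * g x).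
Proof. by move=> cf cg x; apply: cvgM; [exact: cf|exact: cg]. Qed.

Lemma continuous_norm' f : continuous f -> continuous (fun x => `|f x|).
Proof. by move=> cf x; apply: cvg_norm; exact: cf. Qed.

Lemma continuous_cst' (a : R) : continuous (fun _ : T => a).
Proof. by move=> x; exact: cvg_cst. Qed.

Lemma continuous_maxr f g : continuous f -> continuous g ->
  continuous (fun x => Num.max (f x) (g x)).
Proof.
move=> cf cg; have -> : (fun x => Num.max (f x) (g x)) =
    (fun x => (f x + g x + `|f x - g x|) * 2^-1).
  by apply/funext => x; rewrite maxr_absE.
apply: continuousM'; last exact: continuous_cst'.
apply: continuousD'; first exact: continuousD'.
apply: continuous_norm'.
exact: continuousB'.
Qed.

Lemma continuous_minr f g : continuous f -> continuous g ->
  continuous (fun x => Num.min (f x) (g x)).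
Proof.
move=> cf cg; have -> : (fun x => Num.min (f x) (g x)) =
    (fun x => (f x + g x - `|f x - g x|) * 2^-1).
  by apply/funext => x; rewrite minr_absE.
apply: continuousM'; last exact: continuous_cst'.
apply: continuousB'; first exact: continuousD'.
apply: continuous_norm'.
exact: continuousB'.
Qed.

Lemma closed_le_fun f g : continuous f -> continuous g ->
  closed [set x | f x <= g x].
Proof.
move=> cf cg; have -> : [set x | f x <= g x] =
    (fun x => f x - g x) @^-1` [set y | y <= 0].
  by apply/seteqP; split => x /=; rewrite subr_le0.
by apply: closed_preimage; [exact: continuousB'|exact: closed_le].
Qed.

Lemma open_lt_fun f g : continuous f -> continuous g ->
  open [set x | f x < g x].
Proof.
move=> cf cg; have -> : [set x | f x < g x] =
    (fun x => f x - g x) @^-1` [set y | y < 0].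
  by apply/seteqP; split => x /=; rewrite subr_lt0.
by apply: open_comp; [move=> x _; exact: continuousB'|exact: open_lt].
Qed.

End Continuity.

Lemma continuous_comp' (T U V : topologicalType) (f : T -> U) (g : U -> V) :
  continuous f -> continuous g -> continuous (fun x => g (f x)).
Proof. by move=> cf cg x; apply: continuous_comp; [exact: cf|exact: cg]. Qed.

Lemma continuous_pair' (T U V : topologicalType) (f : T -> U) (g : T -> V) :
  continuous f -> continuous g -> continuous (fun x => (f x, g x)).
Proof. by move=> cf cg x; apply: cvg_pair; [exact: cf|exact: cg]. Qed.

Lemma continuous_fst' (T U V : topologicalType) (f : T -> U * V) :
  continuous f -> continuous (fun x => (f x).1).
Proof. by move=> cf x; apply: (cvg_comp _ _ (cf x)); exact: cvg_fst. Qed.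

Lemma continuous_snd' (T U V : topologicalType) (f : T -> U * V) :
  continuous f -> continuous (fun x => (f x).2).
Proof. by move=> cf x; apply: (cvg_comp _ _ (cf x)); exact: cvg_snd. Qed.

Lemma continuous_id' (T : topologicalType) : continuous (fun x : T => x).
Proof. by move=> x; exact: cvg_id. Qed.

Section Retractions.
Variable R : realType.
Local Notation plane := (R * R)%type.
Local Notation uI := (@unit_itv R).
Implicit Types (A B C K L Y : set plane) (z u v w : plane).

(** Points of [K] stay fixed at all times: this lets such homotopies be pasted with the identity and
    lets loops be contracted with a fixed base point. *)
Definition strong_retract A K := exists H : plane * R -> plane,
  [/\ {within A `*` uI, continuous H},
      (forall z s, A z -> uI s -> A (H (z, s))),
      (forall z, A z -> H (z, 0) = z),
      (forall z, A z -> K (H (z, 1))) &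
      (forall z s, K z -> uI s -> H (z, s) = z)].

Lemma unit_itv0 : uI 0. Proof. by rewrite /unit_itv /= lexx ler01. Qed.
Lemma unit_itv1 : uI 1. Proof. by rewrite /unit_itv /= lexx ler01. Qed.

Lemma closed_prod_strip A (a b : R) : closed A ->
  closed (A `*` [set s | a <= s <= b]).
Proof.
move=> cA; have -> : A `*` [set s | a <= s <= b] =
   (fst @^-1` A) `&` ([set z : plane * R | a <= z.2] `&` [set z | z.2 <= b]).
  apply/seteqP; split => z /=; first by case=> ? /andP[].
  by case=> ? [? ?]; split => //; apply/andP.
have c2 : continuous (fun z : plane * R => z.2).
  exact/continuous_snd'/continuous_id'.
apply: closedI.
  apply: closed_preimage cA; exact/continuous_fst'/continuous_id'.
apply: closedI; apply: closed_le_fun => //; exact: continuous_cst'.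
Qed.

(** The homotopies run one after the other at double speed. At time [2^-1] they agree because the
    second starts as the identity of [L]. Closedness of [A] makes both halves of the cylinder
    closed, as pasting requires. *)
Lemma strong_retract_trans A L K : closed A -> K `<=` L -> L `<=` A ->
  strong_retract A L -> strong_retract L K -> strong_retract A K.
Proof.
move=> cA KL LA [H1 [c1 m1 i1 e1 f1]] [H2 [c2 m2 i2 e2 f2]].
pose G1 (q : plane * R) := H1 (q.1, 2 * q.2).
pose G2 (q : plane * R) := H2 (H1 (q.1, 1), 2 * q.2 - 1).
have half_ub (s : R) : uI s -> ~~ (s <= 2^-1) -> uI (2 * s - 1).
  by rewrite /unit_itv /= -ltNge; lra.
have half_lb (s : R) : uI s -> s <= 2^-1 -> uI (2 * s).
  by rewrite /unit_itv /=; lra.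
exists (fun q => if q.2 <= 2^-1 then G1 q else G2 q); split.
- have -> : A `*` uI = (A `*` [set s | 0 <= s <= 2^-1]) `|`
      (A `*` [set s | 2^-1 <= s <= 1]).
    apply/seteqP; split => q /=.
      rewrite /unit_itv /= => -[Aq sq].
      by have [?|?] := leP q.2 2^-1; [left|right]; split => //; lra.
    rewrite /unit_itv /=.
    by case=> -[Aq /andP[? ?]]; split => //; apply/andP; split => //; lra.
  have c1' : continuous (fun q : plane * R => q.1).
    exact/continuous_fst'/continuous_id'.
  have c2' : continuous (fun q : plane * R => 2 * q.2).
    apply: continuousM'; first exact: continuous_cst'.
    exact/continuous_snd'/continuous_id'.
  apply: withinU_continuous; try exact: closed_prod_strip.
    apply: (@within_eq _ _ _ G1) => [q [_ /= /andP[_ ->]] //|].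
    refine (@within_comp _ _ _ _ (A `*` uI)
        (fun q : plane * R => (q.1, 2 * q.2)) H1 _ _ c1).
      move=> _ [q [Aq /= hq] <-]; split => //=.
      by rewrite /unit_itv /=; lra.
    by apply: continuous_subspaceT; exact: continuous_pair'.
  apply: (@within_eq _ _ _ G2) => [q [Aq /= /andP[h1 h2]]|].
    case: ifP => // h3; have q2 : q.2 = 2^-1 by lra.
    rewrite /G1 /G2 q2 divff // subrr i2 //; exact: e1.
  have cH1 : {within A `*` [set s | 2^-1 <= s <= 1],
     continuous (fun q : plane * R => H1 (q.1, 1 : R))}.
    refine (@within_comp _ _ _ _ (A `*` uI)
        (fun q : plane * R => (q.1, 1 : R)) H1 _ _ c1).
      move=> _ [q [Aq /= hq] <-]; split => //=; exact: unit_itv1.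
    apply: continuous_subspaceT; apply: continuous_pair' => //.
    exact: continuous_cst'.
  refine (@within_comp _ _ _ _ (L `*` uI)
     (fun q : plane * R => (H1 (q.1, 1 : R), 2 * q.2 - 1)) H2 _ _ c2).
    move=> _ [q [Aq /= hq] <-]; split => //=; first exact: e1.
    by rewrite /unit_itv /=; lra.
  apply: within_pair => //.
  apply: continuous_subspaceT; apply: continuousB' => //.
  exact: continuous_cst'.
- move=> z s Az us; case: ifPn => /= hs; first by apply: m1 => //; exact: half_lb.
  by apply: LA; apply: m2; [exact: e1|exact: half_ub].
- by move=> z Az /=; rewrite invr_ge0 ler0n /G1 /= mulr0 i1.
- move=> z Az /=; rewrite ifF; last by lra.
  rewrite /G2 /= (_ : 2 * 1 - 1 = 1 :> R); last by lra.
  by apply: e2; exact: e1.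
- move=> z s Kz us; have Lz := KL _ Kz; case: ifPn => /= hs.
    by apply: f1 => //; exact: half_lb.
  rewrite /G2 /= f1 //; last exact: unit_itv1.
  by apply: f2 => //; exact: half_ub.
Qed.

(** The homotopy is continued by the identity on [B]. Both agree on the overlap of [A] and [B],
    which lies in [L] and so is not moved by [H]. *)
Lemma strong_retract_extend A B L : closed A -> closed B ->
  A `&` B `<=` L -> L `<=` A ->
  strong_retract A L -> strong_retract (A `|` B) (L `|` B).
Proof.
move=> cA cB ABL LA [H [cH mH iH eH fH]].
exists (fun q => if q.1 \in A then H q else q.1); split.
- have -> : (A `|` B) `*` uI = (A `*` uI) `|` (B `*` uI).
    apply/seteqP; split => q /=; first by case=> -[?|?] ?; [left|right].
    by case=> -[? ?]; split => //; [left|right].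
  apply: withinU_continuous; try exact: closed_prod_strip.
    by apply: within_eq cH => q [Aq _]; rewrite mem_set.
  apply: (@within_eq _ _ _ fst) => [[z s] [/= Bz us]|].
    case: ifPn => //; rewrite inE => Az; rewrite fH //; exact: ABL.
  by apply: continuous_subspaceT; exact/continuous_fst'/continuous_id'.
- move=> z s ABz us /=; case: ifPn => //; rewrite inE => Az; left; exact: mH.
- by move=> z ABz /=; case: ifPn => //; rewrite inE; exact: iH.
- move=> z ABz /=; case: ifPn; first by rewrite inE => Az; left; exact: eH.
  by move/negP; rewrite inE; case: ABz => // Bz _; right.
- move=> z s LBz us /=; case: ifPn => //; rewrite inE => Az.
  by apply: fH => //; case: LBz => // Bz; exact: ABL.
Qed.

Definition vert_line (a : R) (I : set R) : set plane := [set z | z.1 = a /\ I z.2].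

(** Lying on one vertical line and convexity in a single condition. A [vsegment] may thus be a
    point, a bounded segment, a half line or a line. *)
Definition vconvex K := forall u v, K u -> K v -> u.1 = v.1 /\
  forall w, w.1 = u.1 -> u.2 <= w.2 <= v.2 -> K w.

Definition vsegment K := [/\ closed K, K !=set0 & vconvex K].

(** The retraction clamps to [inf I] and [sup I], leaving out a bound that does not exist. *)
Lemma interval_retraction (I : set R) : is_interval I -> closed I ->
  I !=set0 -> exists r : R -> R,
  [/\ continuous r, forall y, I (r y) & forall y, I y -> r y = y].
Proof.
move=> iI cI I0.
have cl_sup : has_ubound I -> I (sup I).
  by move=> ub; apply: cI; exact: closure_sup.
have cl_inf : has_lbound I -> I (inf I).
  move=> lb; apply: cI => V /nbhs_ballP[e /= e0 eV].
  have [x Ix xe] := inf_adherent e0 (conj I0 lb); exists x; split => //.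
  have := ge_inf lb Ix => ix.
  by apply: eV; rewrite /ball /= ler0_norm; lra.
have [x0 Ix0] := I0.
pose up y := if pselect (has_ubound I) then Num.min y (sup I) else y.
pose r y := if pselect (has_lbound I) then Num.max (inf I) (up y) else up y.
have cup : continuous up.
  rewrite /up; case: pselect => ?; last exact: continuous_id'.
  by apply: continuous_minr; [exact: continuous_id'|exact: continuous_cst'].
exists r; split.
- rewrite /r; case: pselect => // ?.
  by apply: continuous_maxr => //; exact: continuous_cst'.
- move=> y.
  have upI : exists2 x, I x & up y <= x.
    rewrite /up; case: pselect => [ub|nub] /=.
      by exists (sup I); [exact: cl_sup|rewrite ge_min lexx orbT].
    apply: contrapT => nx; apply: nub; exists y => x Ix.
    by rewrite leNgt; apply/negP => yx; apply: nx; exists x => //; exact: ltW.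
  have [x1 Ix1 hx1] := upI.
  rewrite /r; case: pselect => [lb|nlb] /=.
    have Ii := cl_inf lb.
    apply: (iI (inf I) x1) => //; rewrite le_max lexx /= ge_max hx1 andbT.
    exact: ge_inf.
  have [x2 Ix2 hx2] : exists2 x, I x & x <= up y.
    apply: contrapT => nx; apply: nlb; exists (up y) => x Ix.
    by rewrite leNgt; apply/negP => yx; apply: nx; exists x => //; exact: ltW.
  by apply: (iI x2 x1) => //; rewrite hx2.
- move=> y Iy; rewrite /r; have -> : up y = y.
    rewrite /up; case: pselect => [ub|//] /=; apply/min_idPl.
    exact: ub_le_sup.
  by case: pselect => [lb|//] /=; apply/max_idPr; exact: ge_inf.
Qed.

Lemma vsegmentP K : vsegment K -> exists (a : R) (I : set R),
  [/\ is_interval I, closed I, I !=set0 & K = vert_line a I].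
Proof.
move=> [cK [z Kz] vK]; exists z.1, [set y | K (z.1, y)]; split.
- move=> x y Kx Ky t xty; have [_] := vK _ _ Kx Ky; exact.
- apply: (@closed_preimage _ _ (fun y : R => (z.1, y))) => //.
  by apply: continuous_pair'; [exact: cst_continuous|exact: continuous_id'].
- by exists z.2; move: Kz; rewrite /= -surjective_pairing.
- apply/seteqP; split => u /=.
    move=> Ku; have [zu _] := vK _ _ Kz Ku.
    by split; rewrite //= zu -surjective_pairing.
  by move=> [/= <-]; rewrite -surjective_pairing.
Qed.

Lemma vert_line_strong_retract (a : R) (I J : set R) : is_interval J ->
  is_interval I -> closed I -> I !=set0 -> I `<=` J ->
  strong_retract (vert_line a J) (vert_line a I).
Proof.
move=> iJ iI cI I0 IJ; have [r [cr Ir rI]] := interval_retraction iI cI I0.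
exists (fun q => (q.1.1, q.1.2 + q.2 * (r q.1.2 - q.1.2))); split => /=.
- apply: continuous_subspaceT.
  have c1 : continuous (fun q : plane * R => q.1).
    exact/continuous_fst'/continuous_id'.
  have c12 : continuous (fun q : plane * R => q.1.2) by exact: continuous_snd'.
  apply: continuous_pair'; first exact: continuous_fst'.
  apply: continuousD' => //; apply: continuousM'.
    exact/continuous_snd'/continuous_id'.
  by apply: continuousB' => //; exact: continuous_comp'.
- move=> z s [za Jz] /andP[s0 s1]; split => //=.
  have Jr : J (r z.2) by apply: IJ.
  have [h|h] := leP z.2 (r z.2).
    apply: (iJ z.2 (r z.2)) => //; apply/andP; split; nra.
  by apply: (iJ (r z.2) z.2) => //; apply/andP; split; nra.
- by move=> [x y] _ /=; rewrite mul0r addr0.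
- by move=> z [za _]; split => //=; rewrite mul1r addrC subrK.
- by move=> [x y] s [/= _ Iy] _; rewrite rI // subrr mulr0 addr0.
Qed.

Lemma connected_closed_cover (T : topologicalType) (D E F : set T) :
  connected D -> closed E -> closed F -> D `<=` E `|` F ->
  D `&` E !=set0 -> D `&` F !=set0 -> exists x, [/\ D x, E x & F x].
Proof.
move=> cD cE cF DEF DE [x [Dx Fx]]; apply: contrapT => nx.
have DED : D `&` E = D.
  apply: cD => //; last by exists E.
  exists (~` F); first exact: closed_openC.
  apply/seteqP; split => y [Dy]; last by move=> nF; have [] := DEF _ Dy.
  by move=> Ey; split => // Fy; apply: nx; exists y.
by apply: nx; exists x; split => //; move: Dx; rewrite -{1}DED; case.
Qed.

Lemma vert_line_connected (a : R) (I : set R) : is_interval I -> connected (vert_line a I).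
Proof.
move=> /connected_intervalP cI.
have -> : vert_line a I = (fun y => (a, y)) @` I.
  apply/seteqP; split => [[x y] /= [/= -> Iy]|_ [y Iy <-]] //.
  by exists y.
apply: connected_continuous_connected => //; apply: continuous_subspaceT.
by apply: continuous_pair'; [exact: cst_continuous|exact: continuous_id'].
Qed.

Lemma vsegment_connected K : vsegment K -> connected K.
Proof. by move=> /vsegmentP[a [I [iI _ _ ->]]]; exact: vert_line_connected. Qed.

Definition vseg u v : set plane := [set w | w.1 = u.1 /\ u.2 <= w.2 <= v.2].

Lemma vseg_connected u v : connected (vseg u v).
Proof.
apply: (@vert_line_connected u.1 [set y | u.2 <= y <= v.2]) => x y /= hx hy z hz.
by move: hx hy hz; lra.
Qed.

Lemma vsegment1 z : vsegment [set z].
Proof.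
split; first exact: accessible_closed_set1 (hausdorff_accessible _) _.
- by exists z.
- move=> u v -> ->; split => // w /= w1 w2; rewrite [w]surjective_pairing w1.
  by rewrite [RHS]surjective_pairing; congr pair; lra.
Qed.

(** Points are vertical segments, so retractions onto points are included. Segments are needed
    because pieces are glued along one, onto which a piece has to be retracted. *)
Definition treelike A :=
  closed A /\ forall K, vsegment K -> K `<=` A -> strong_retract A K.

(** A path from [x] to [y] is the track of [x] under the retraction onto [y]. *)
Lemma treelike_path_connected A : treelike A -> path_connected A.
Proof.
move=> [cA tA] x y Ax Ay.
have [|H [cH mH iH eH fH]] := tA _ (vsegment1 y); first by move=> _ ->.
exists (fun s => H (x, s)); split; last first.
  split; first exact: iH.
  by split; [exact: eH|move=> _ [s us <-]; exact: mH].
refine (@within_comp _ _ _ _ (A `*` uI) (fun s : R => (x, s)) H _ _ cH).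
  by move=> _ [s us <-].
apply: continuous_subspaceT.
by apply: continuous_pair'; [exact: cst_continuous|exact: continuous_id'].
Qed.

Lemma treelike_loops_contractible A : treelike A -> loops_contractible A.
Proof.
move=> [cA tA] g cg gA g01; have Ag s : uI s -> A (g s).
  by move=> us; apply: gA; exists s.
have Ag0 := Ag _ unit_itv0.
have [|H [cH mH iH eH fH]] := tA _ (vsegment1 (g 0)); first by move=> _ ->.
exists (fun q => H (g q.1, q.2)); split.
  refine (@within_comp _ _ _ _ (A `*` uI)
    (fun q : plane => (g q.1, q.2)) H _ _ cH).
    by move=> _ [q [u1 u2] <-]; split => //; exact: Ag.
  apply: within_pair.
    refine (@within_comp _ _ _ _ uI fst g _ _ cg).
      by move=> _ [q [u1 u2] <-].
    by apply: continuous_subspaceT; exact/continuous_fst'/continuous_id'.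
  by apply: continuous_subspaceT; exact/continuous_snd'/continuous_id'.
split; first by move=> _ [q [u1 u2] <-]; apply: mH => //; exact: Ag.
split=> s us /=; first by split; [exact/iH/Ag|exact/eH/Ag].
by rewrite -g01 fH.
Qed.

Lemma path_connected_connected A : path_connected A -> connected A.
Proof.
move=> pA; have [->|/set0P[x Ax]] := eqVneq A set0; first exact: connected0.
have /choice[g Pg] : forall y, exists g : R -> plane, A y ->
    {within uI, continuous g} /\ g 0 = x /\ g 1 = y /\ g @` uI `<=` A.
  move=> y; have [Ay|nAy] := pselect (A y); last by exists (fun=> x).
  by have [g Pg] := pA _ _ Ax Ay; exists g.
have -> : A = \bigcup_(y in A) (g y @` uI).
  apply/seteqP; split => [y Ay|y [z Az]].
    by exists y => //; exists 1; [exact: unit_itv1|have [_ [_ []]] := Pg _ Ay].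
  by have [_ [_ [_]]] := Pg _ Az; exact.
apply: bigcup_connected.
  by exists x => y Ay; exists 0; [exact: unit_itv0|have [_ []] := Pg _ Ay].
move=> y Ay; apply: connected_continuous_connected.
  by apply/connected_intervalP => a b /= ha hb c hc; rewrite /unit_itv /=;
    move: ha hb hc; rewrite /unit_itv /=; lra.
by have [] := Pg _ Ay.
Qed.

Lemma treelike_connected A : treelike A -> connected A.
Proof. by move=> /treelike_path_connected; exact: path_connected_connected. Qed.

Lemma vconvexU K L z : vconvex K -> vconvex L -> K z -> L z -> vconvex (K `|` L).
Proof.
have aux K1 L1 u v : vconvex K1 -> vconvex L1 -> K1 z -> L1 z -> K1 u -> L1 v ->
    u.1 = v.1 /\ (forall w, w.1 = u.1 -> u.2 <= w.2 <= v.2 -> K1 w \/ L1 w).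
  move=> cK cL Kz Lz Ku Lv.
  have [uz hu] := cK _ _ Ku Kz; have [zv hv] := cL _ _ Lz Lv.
  split=> [|w wu hw]; first by rewrite uz.
  have [wz|zw] := leP w.2 z.2; first by left; apply: hu => //; lra.
  by right; apply: hv; [rewrite wu|lra].
move=> cK cL Kz Lz u v [Ku|Lu] [Kv|Lv].
- by have [? h] := cK _ _ Ku Kv; split => // w w1 w2; left; exact: h.
- exact: aux.
- by have [? h] := aux _ _ _ _ cL cK Lz Kz Lu Kv; split => // w w1 w2; apply/or_comm; exact: h.
- by have [? h] := cL _ _ Lu Lv; split => // w w1 w2; right; exact: h.
Qed.

(** First [B] collapses onto the common segment while [A] stands still; then [A] retracts onto
    [K]. *)
Lemma treelike_glue_left A B K : treelike A -> treelike B ->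
  vsegment (A `&` B) -> vsegment K -> K `<=` A -> strong_retract (A `|` B) K.
Proof.
move=> [cA tA] [cB tB] sAB sK KA.
have AB_A : (A `&` B) `|` A = A by rewrite setUidr //; apply: subIsetl.
apply: (@strong_retract_trans _ A) => //; first exact: closedU.
- rewrite setUC -{2}AB_A; apply: strong_retract_extend => //.
    by rewrite setIC.
  by apply: tB => //; exact: subIsetr.
- exact: tA.
Qed.

(** If [w] lies in [K] between two points of [A], but in [B], then the segments joining [w] to these
    two points each contain a point of both [A] and [B]. Convexity of the common segment puts [w] in
    it. *)
Lemma vsegment_part A B K : closed A -> closed B -> vsegment K ->
  K `<=` A `|` B -> vsegment (A `&` B) -> K `&` A !=set0 -> vsegment (K `&` A).
Proof.
move=> cA cB [cK K0 vK] KAB [_ _ vAB] KA0; split => //; first exact: closedI.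
move=> u v [Ku Au] [Kv Av]; have [uv hK] := vK _ _ Ku Kv; split => // w wu huv.
have Kw := hK _ wu huv; split => //.
have [//|Bw] := KAB _ Kw.
have huw : vseg u w `<=` A `|` B.
  by move=> x [x1 x2]; apply: KAB; apply: hK => //; lra.
have hwv : vseg w v `<=` A `|` B.
  by move=> x [x1 x2]; apply: KAB; apply: hK; [rewrite x1|lra].
have uw : vseg u w w by split => //; lra.
have [||x [[x1 x2] Ax Bx]] := connected_closed_cover (@vseg_connected u w) cA cB huw.
- by exists u; split => //; split => //; lra.
- by exists w.
have [||y [[y1 y2] Ay By]] := connected_closed_cover (@vseg_connected w v) cA cB hwv.
- by exists v; split => //; split; rewrite ?wu //; lra.
- by exists w; split => //; split => //; lra.
have [_ h] := vAB _ _ (conj Ax Bx) (conj Ay By).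
by have [] : (A `&` B) w by apply: h; [rewrite x1|lra].
Qed.

Lemma treelike_glue A B : treelike A -> treelike B -> vsegment (A `&` B) ->
  treelike (A `|` B).
Proof.
move=> tA tB sAB; have [cA rA] := tA; have [cB rB] := tB.
split; [exact: closedU|move=> K sK KAB].
have [KA|/existsNP[k1 /not_implyP[Kk1 Ak1]]] := pselect (K `<=` A).
  exact: treelike_glue_left.
have [KB|/existsNP[k2 /not_implyP[Kk2 Bk2]]] := pselect (K `<=` B).
  by rewrite setUC; apply: treelike_glue_left => //; rewrite setIC.
have Bk1 : B k1 by have [] := KAB _ Kk1.
have Ak2 : A k2 by have [] := KAB _ Kk2.
have KA0 : K `&` A !=set0 by exists k2.
have KB0 : K `&` B !=set0 by exists k1.
have [p [Kp Ap Bp]] :=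
  connected_closed_cover (vsegment_connected sK) cA cB KAB KA0 KB0.
have sKA := vsegment_part cA cB sK KAB sAB KA0.
have sKB : vsegment (K `&` B).
  by apply: (vsegment_part cB cA) => //; rewrite 1?setUC 1?setIC.
have [cK _ vK] := sK; have [cAB _ vAB] := sAB.
(* Each is a union of two vertical segments through [p], hence a vertical segment; so [A] retracts
   onto [L1] and [B] onto [L2]. *)
pose L1 := (K `&` A) `|` (A `&` B); pose L2 := (K `&` B) `|` (A `&` B).
have sL1 : vsegment L1.
  have [c1 _ v1] := sKA; split; first exact: closedU.
    by exists p; left.
  exact: (vconvexU v1 vAB (conj Kp Ap) (conj Ap Bp)).
have sL2 : vsegment L2.
  have [c1 _ v1] := sKB; split; first exact: closedU.
    by exists p; left.
  exact: (vconvexU v1 vAB (conj Kp Bp) (conj Ap Bp)).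
have L1A : L1 `<=` A by move=> z [] [].
have L2B : L2 `<=` B by move=> z [] [].
pose M := K `|` (A `&` B).
have step1 : strong_retract (A `|` B) (B `|` (K `&` A)).
  have -> : B `|` (K `&` A) = L1 `|` B.
    apply/seteqP; split => z; rewrite /L1 /=; first by case; auto.
    by case=> [[|[]]|]; auto.
  apply: strong_retract_extend => //; last exact: rA.
  by move=> z; right.
have step2 : strong_retract (B `|` (K `&` A)) M.
  have -> : M = L2 `|` (K `&` A).
    apply/seteqP; split => z; rewrite /L2 /M /=.
      by case=> [Kz|]; auto; have [] := KAB _ Kz; auto.
    by case=> [[[]|]|[]]; auto.
  apply: strong_retract_extend => //; first exact: closedI.
  - by move=> z [Bz [Kz Az]]; right.
  - exact: rB.
(* [M] only prolongs [K] along its own vertical line, so sliding within that line suffices. *)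
have step3 : strong_retract M K.
  have /vsegmentP[a [J [iJ cJ J0 defM]]] : vsegment M.
    split; [exact: closedU|by exists p; left|exact: (vconvexU vK vAB Kp (conj Ap Bp))].
  have /vsegmentP[b [I [iI cI I0 defK]]] := sK.
  have IJ y : I y -> b = a /\ J y.
    move=> Iy; have : M (b, y) by left; rewrite defK.
    by rewrite defM => -[].
  have [y0 Iy0] := I0; have [ba _] := IJ _ Iy0.
  rewrite defM defK ba; apply: vert_line_strong_retract => // y /IJ[]//.
have KM : K `<=` M by move=> z; left.
have MB : M `<=` B `|` (K `&` A).
  by move=> z [Kz|[]]; [have [] := KAB _ Kz; rewrite /=; auto|left].
have cBK : closed (B `|` (K `&` A)) by apply: closedU => //; exact: closedI.
apply: (@strong_retract_trans _ (B `|` (K `&` A))) => //.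
- exact: closedU.
- exact: subset_trans MB.
- by move=> z [Bz|[_ Az]]; [right|left].
- exact: (@strong_retract_trans _ M).
Qed.

(** Built piece by piece, so that a new band can absorb the pieces it meets in an induction. *)
Inductive forest : set plane -> Prop :=
| forest0 : forest set0
| forestU C Y : treelike C -> forest Y -> C `&` Y = set0 -> forest (C `|` Y).

Lemma forest_closed Y : forest Y -> closed Y.
Proof.
elim=> [|C Z [cC _] _ cZ _]; [exact: closed0|exact: closedU].
Qed.

(** The points lie in the same connected component of [Y]. *)
Definition linked Y u v := exists D, [/\ connected D, D `<=` Y, D u & D v].

(** Induction over the pieces of [Y] with [B] varying. A piece that misses [B] is set aside; a piece
    that meets [B] does so in a vertical segment, is glued to it, and the enlarged set is attached
    to the rest. The hypothesis survives because the absorbed piece is disjoint from the remaining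
    ones. *)
Lemma forest_attach Y B : forest Y -> treelike B ->
  (forall u v, B u -> B v -> linked Y u v ->
     u.1 = v.1 /\ vseg u v `<=` Y `&` B) ->
  forest (B `|` Y).
Proof.
move=> fY; elim: fY B => [|C Z tC fZ IH CZ] B tB hB.
  by apply: forestU => //; [exact: forest0|rewrite setI0].
have [cC _] := tC; have cZ := forest_closed fZ.
have disj z : C z -> Z z -> False.
  by move=> Cz Zz; have : (C `&` Z) z by []; rewrite CZ.
have hC D u : connected D -> D `<=` C `|` Z -> D u -> C u -> D `<=` C.
  move=> cD DCZ Du Cu w Dw; have [//|Zw] := DCZ _ Dw.
  have [||x [_ Cx Zx]] := connected_closed_cover cD cC cZ DCZ.
  - by exists u.
  - by exists w.
  - by have := disj _ Cx Zx.
have hZ D u : connected D -> D `<=` C `|` Z -> D u -> Z u -> D `<=` Z.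
  move=> cD DCZ Du Zu w Dw; have [Cw|//] := DCZ _ Dw.
  have [||x [_ Cx Zx]] := connected_closed_cover cD cC cZ DCZ.
  - by exists w.
  - by exists u.
  - by have := disj _ Cx Zx.
have vuu u v : u.2 <= v.2 -> vseg u v u by move=> ?; split => //; lra.
have segZ B' u v : B `<=` B' -> B u -> B v -> linked Z u v ->
    u.1 = v.1 /\ vseg u v `<=` Z `&` B'.
  move=> BB' Bu Bv [D [cD DZ Du Dv]].
  have [|uv huv] := hB _ _ Bu Bv.
    by exists D; split => // w /DZ; right.
  split => // w hw; split; last by apply: BB'; have [] := huv _ hw.
  apply: (hZ (vseg u v) u) => //.
  - exact: vseg_connected.
  - by move=> x /huv[].
  - by apply: vuu; case: hw => _; lra.
  - exact: DZ.
have [[z [Bz Cz]]|/set0P/negP/negPn/eqP BC0] := pselect (B `&` C !=set0); last first.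
  rewrite setUCA; apply: forestU => //.
    by apply: IH => // u v Bu Bv; exact: segZ.
  by rewrite setIUr (setIC C) BC0 CZ set0U.
have sBC : vsegment (B `&` C).
  split; [by apply: closedI => //; case: tB|by exists z|].
  move=> u v [Bu Cu] [Bv Cv].
  have [|uv huv] := hB _ _ Bu Bv.
    by exists C; split => //; exact: treelike_connected.
  split => // w w1 w2; have hw : vseg u v w by [].
  split; first by have [] := huv _ hw.
  apply: (hC (vseg u v) u) => //.
  - exact: vseg_connected.
  - by move=> x /huv[].
  - by apply: vuu; lra.
rewrite setUA; apply: IH; first exact: treelike_glue.
move=> u v BCu BCv /[dup] lk [D [cD DZ Du Dv]].
have BZ x : Z x -> (B `|` C) x -> B x by move=> Zx [//|/disj]; move/(_ Zx).
have Bu := BZ _ (DZ _ Du) BCu; have Bv := BZ _ (DZ _ Dv) BCv.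
by apply: segZ => // x; left.
Qed.

(** The closed complement [Z] records that [C i] is open and closed in [Y]. *)
Lemma forest_components Y : forest Y -> exists (n : nat) (C : nat -> set plane),
  [/\ forall i, (i < n)%N -> treelike (C i) /\
        exists2 Z, closed Z & C i `&` Z = set0 /\ C i `|` Z = Y,
      forall i j, (i < n)%N -> (j < n)%N -> i <> j -> C i `&` C j = set0 &
      Y = \bigcup_(i in `I_n) C i].
Proof.
elim=> [|C0 Z tC fZ [n [C [hC dC defZ]]] CZ].
  by exists 0%N, (fun=> set0); split => //; rewrite II0 bigcup_set0.
have CZi i : (i < n)%N -> C i `<=` Z by move=> ni; rewrite defZ => z ?; exists i.
have d0 i : (i < n)%N -> C0 `&` C i = set0.
  move=> ni; rewrite -subset0 -CZ => z [C0z /(CZi _ ni) Zz] //.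
exists n.+1, (fun i => if i is i'.+1 then C i' else C0); split.
- case=> [_|i]; first by split => //; exists Z => //; exact: forest_closed.
  rewrite ltnS => ni; have [tCi [Z' cZ' [d e]]] := hC _ ni; split => //.
  exists (C0 `|` Z'); first by apply: closedU => //; case: tC.
  split; first by rewrite setIUr setIC d0 // d set0U.
  by rewrite setUCA e.
- case=> [|i] [|j] //; rewrite ?ltnS => hi hj ij.
  + exact: d0.
  + by rewrite setIC d0.
  + by apply: dC => // ?; apply: ij; congr _.+1.
- apply/seteqP; split => z.
    case=> [C0z|]; first by exists 0%N.
    by rewrite {1}defZ => -[i ni Ciz]; exists i.+1.
  by case=> -[_ C0z|i ni Ciz]; [left|right; exact: (CZi i)].
Qed.

End Retractions.

(** * Bands over vertical strips *)

Lemma closed_curve (R : realType) (T : topologicalType) (C : set T) (e : R -> T) :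
  closed C -> continuous e ->
  (exists2 eps, 0 < eps & forall d, 0 < d < eps -> C (e d)) -> C (e 0).
Proof.
move=> cC ce [eps eps0 he]; apply: cC => V /(ce 0) /nbhs_ballP[r /= r0 rV].
pose d := Num.min (r / 2) (eps / 2).
have d0 : 0 < d by rewrite lt_min !divr_gt0.
exists (e d); split.
  apply: he; rewrite d0 /= /d gt_min; apply/orP; right; lra.
apply: rV; rewrite /ball /= sub0r normrN gtr0_norm // /d gt_min; apply/orP; left.
lra.
Qed.

Lemma nbhs_right_exists (R : realType) (V : set R) (x : R) : nbhs x V ->
  exists2 d, 0 < d & forall s, 0 <= s <= d -> V (x + s) /\ V (x - s).
Proof.
move=> /nbhs_ballP[r /= r0 rV]; exists (r / 2); first by rewrite divr_gt0.
move=> s /andP[s0 sr]; split; apply: rV; rewrite /ball /=.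
  by rewrite opprD addrA subrr sub0r normrN ger0_norm //; lra.
by rewrite opprB addrC subrK ger0_norm //; lra.
Qed.

Lemma closed_true (T : topologicalType) : closed [set _ : T | true].
Proof. by rewrite (_ : mkset _ = setT); [exact: closedT|apply/seteqP]. Qed.

Lemma open_true (T : topologicalType) : open [set _ : T | true].
Proof. by rewrite (_ : mkset _ = setT); [exact: openT|apply/seteqP]. Qed.

(** * Bounds that may be infinite *)

Section OptionBounds.
Variable R : realType.
Implicit Types (lo hi : option R) (f g : option (R -> R)).

Definition geo lo (y : R) := if lo is Some l then l <= y else true.
Definition leo hi (y : R) := if hi is Some h then y <= h else true.
Definition gto lo (y : R) := if lo is Some l then l < y else true.
Definition lto hi (y : R) := if hi is Some h then y < h else true.
Definition olt lo hi :=
  match lo, hi with Some l, Some h => l < h | _, _ => true end.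
Definition ole lo hi :=
  match lo, hi with Some l, Some h => l <= h | _, _ => true end.
Definition appo f x : option R := omap (fun h => h x) f.
Definition cont_o f : Prop := if f is Some h then continuous h else True.

(** The maximum comes last, so the lower bound always holds, while the upper one relies on
    [ole lo hi]. *)
Definition clampo lo hi y : R :=
  let y' := if hi is Some h then Num.min y h else y in
  if lo is Some l then Num.max l y' else y'.

(** A point between the bounds that depends continuously on them, available also when a bound is
    infinite. *)
Definition mido lo hi : R :=
  match lo, hi with
  | Some l, Some h => (l + h) / 2 | Some l, None => l + 1
  | None, Some h => h - 1 | None, None => 0 end.

Lemma geo_clampo lo hi y : geo lo (clampo lo hi y).
Proof. by case: lo => [l|] //=; rewrite le_max lexx. Qed.

Lemma leo_clampo lo hi y : ole lo hi -> leo hi (clampo lo hi y).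
Proof.
case: hi lo => [h|] [l|] //= lh; last by rewrite ge_min lexx orbT.
by rewrite ge_max lh ge_min lexx orbT.
Qed.

Lemma clampo_id lo hi y : geo lo y -> leo hi y -> clampo lo hi y = y.
Proof.
case: lo hi => [l|] [h|] //= ly yh; do ?[rewrite (min_idPl _)//].
all: by apply/max_idPr.
Qed.

Lemma gto_mido lo hi : olt lo hi -> gto lo (mido lo hi).
Proof. by case: lo hi => [l|] [h|] //=; lra. Qed.

Lemma lto_mido lo hi : olt lo hi -> lto hi (mido lo hi).
Proof. by case: lo hi => [l|] [h|] //=; lra. Qed.

Lemma gtoW lo y : gto lo y -> geo lo y.
Proof. by case: lo => //= l; exact: ltW. Qed.

Lemma ltoW hi y : lto hi y -> leo hi y.
Proof. by case: hi => //= h; exact: ltW. Qed.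

Lemma oltW lo hi : olt lo hi -> ole lo hi.
Proof. by case: lo hi => [l|] [h|] //=; exact: ltW. Qed.

Lemma geo_convex lo x y (s : R) : 0 <= s <= 1 -> geo lo x -> geo lo y ->
  geo lo (x + s * (y - x)).
Proof. by case: lo => //= l; nra. Qed.

Lemma leo_convex hi x y (s : R) : 0 <= s <= 1 -> leo hi x -> leo hi y ->
  leo hi (x + s * (y - x)).
Proof. by case: hi => //= l; nra. Qed.

Lemma gto_convex lo x y (s : R) : 0 < s <= 1 -> geo lo x -> gto lo y ->
  gto lo (x + s * (y - x)).
Proof. by case: lo => //= l; nra. Qed.

Lemma lto_convex hi x y (s : R) : 0 < s <= 1 -> leo hi x -> lto hi y ->
  lto hi (x + s * (y - x)).
Proof. by case: hi => //= l; nra. Qed.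

Variable T : topologicalType.
Implicit Types (a b : T -> R).

Lemma continuous_clampo f g a b : cont_o f -> cont_o g ->
  continuous a -> continuous b ->
  continuous (fun q => clampo (appo f (a q)) (appo g (a q)) (b q)).
Proof.
move=> cf cg ca cb.
have cup : continuous (fun q =>
    if appo g (a q) is Some h then Num.min (b q) h else b q).
  case: g cg => [h|] //= ch; apply: continuous_minr => //.
  exact: continuous_comp'.
rewrite /clampo; case: f cf => [h|] //= ch.
by apply: continuous_maxr => //; exact: continuous_comp'.
Qed.

Lemma continuous_mido f g a : cont_o f -> cont_o g -> continuous a ->
  continuous (fun q => mido (appo f (a q)) (appo g (a q))).
Proof.
have c1 (c : R) : continuous (fun _ : T => c) by exact: continuous_cst'.
case: f g => [f|] [g|] //= cf cg ca.
- apply: continuousM' => //; apply: continuousD'; exact: continuous_comp'.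
- by apply: continuousD' => //; exact: continuous_comp'.
- by apply: continuousB' => //; exact: continuous_comp'.
Qed.

Lemma closed_geo f a b : cont_o f -> continuous a -> continuous b ->
  closed [set q | geo (appo f (a q)) (b q)].
Proof.
case: f => [f|] /= cf ca cb; last exact: closed_true.
by apply: closed_le_fun => //; exact: continuous_comp'.
Qed.

Lemma closed_leo f a b : cont_o f -> continuous a -> continuous b ->
  closed [set q | leo (appo f (a q)) (b q)].
Proof.
case: f => [f|] /= cf ca cb; last exact: closed_true.
by apply: closed_le_fun => //; exact: continuous_comp'.
Qed.

Lemma open_gto f a b : cont_o f -> continuous a -> continuous b ->
  open [set q | gto (appo f (a q)) (b q)].
Proof.
case: f => [f|] /= cf ca cb; last exact: open_true.
by apply: open_lt_fun => //; exact: continuous_comp'.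
Qed.

Lemma open_lto f a b : cont_o f -> continuous a -> continuous b ->
  open [set q | lto (appo f (a q)) (b q)].
Proof.
case: f => [f|] /= cf ca cb; last exact: open_true.
by apply: open_lt_fun => //; exact: continuous_comp'.
Qed.

End OptionBounds.

Section Bands.
Variable R : realType.
Local Notation plane := (R * R)%type.

(* The strip [ba, bb] and the bounding graphs [bf <= y <= bg]; [None] stands
   for an infinite bound. *)
Record band := Band {
  ba : option R; bb : option R; bf : option (R -> R); bg : option (R -> R) }.

Implicit Types B : band.

Definition cstrip B x := geo (ba B) x && leo (bb B) x.
Definition ostrip B x := gto (ba B) x && lto (bb B) x.
Definition cband B : set plane := [set z | cstrip B z.1 &&
  (geo (appo (bf B) z.1) z.2 && leo (appo (bg B) z.1) z.2)].
Definition oband B : set plane := [set z | ostrip B z.1 &&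
  (gto (appo (bf B) z.1) z.2 && lto (appo (bg B) z.1) z.2)].

(** The graphs are separated over the open strip only; over an end of the strip they may touch, and
    the side there shrinks to a point. *)
Definition bandwf B := [/\ exists x, ostrip B x, cont_o (bf B), cont_o (bg B) &
  forall x, ostrip B x -> olt (appo (bf B) x) (appo (bg B) x)].

Let c1 : continuous (fun z : plane => z.1).
Proof. exact/continuous_fst'/continuous_id'. Qed.
Let c2 : continuous (fun z : plane => z.2).
Proof. exact/continuous_snd'/continuous_id'. Qed.

Lemma ostripW B x : ostrip B x -> cstrip B x.
Proof. by move=> /andP[? ?]; rewrite /cstrip gtoW ?ltoW. Qed.

Lemma obandW B z : oband B z -> cband B z.
Proof. by move=> /and3P[ox ? ?]; apply/and3P; split; rewrite ?ostripW ?gtoW ?ltoW. Qed.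

Lemma cstrip_convex B x y (s : R) : 0 <= s <= 1 -> cstrip B x -> cstrip B y ->
  cstrip B (x + s * (y - x)).
Proof.
by move=> s01 /andP[? ?] /andP[? ?]; rewrite /cstrip geo_convex ?leo_convex.
Qed.

Lemma ostrip_convex B x y (s : R) : 0 < s <= 1 -> cstrip B x -> ostrip B y ->
  ostrip B (x + s * (y - x)).
Proof.
by move=> s01 /andP[? ?] /andP[? ?]; rewrite /ostrip gto_convex ?lto_convex.
Qed.

Lemma continuous_affine (x y : R) : continuous (fun d : R => x + d * (y - x)).
Proof.
apply: continuousD'; first exact: continuous_cst'.
by apply: continuousM'; [exact: continuous_id'|exact: continuous_cst'].
Qed.

(** An end of the strip is approached along the segment to an interior abscissa. *)
Lemma cstrip_closed_prop B (C : set R) : (exists x, ostrip B x) -> closed C ->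
  (forall x, ostrip B x -> C x) -> forall x, cstrip B x -> C x.
Proof.
move=> [x0 ox0] cC hC x cx.
rewrite (_ : x = x + 0 * (x0 - x)); last by rewrite mul0r addr0.
apply: (@closed_curve _ _ C (fun d => x + d * (x0 - x))) => //.
  exact: continuous_affine.
exists 1 => // d d01; apply: hC; apply: ostrip_convex => //; lra.
Qed.

Lemma band_ole B x : bandwf B -> cstrip B x -> ole (appo (bf B) x) (appo (bg B) x).
Proof.
move=> [ne cf cg lt]; apply: (@cstrip_closed_prop B
  [set y | ole (appo (bf B) y) (appo (bg B) y)]) => //; last first.
  by move=> y /lt; exact: oltW.
case: (bf B) (bg B) cf cg => [f|] [g|] //= cf cg; try exact: closed_true.
exact: closed_le_fun.
Qed.

Lemma cband_closed B : bandwf B -> closed (cband B).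
Proof.
move=> [_ cf cg _].
have -> : cband B = (([set z | geo (ba B) z.1] `&` [set z | leo (bb B) z.1]) `&`
   ([set z | geo (appo (bf B) z.1) z.2] `&` [set z | leo (appo (bg B) z.1) z.2])).
  apply/seteqP; split => z /=; first by move=> /andP[/andP[? ?] /andP[? ?]].
  by case=> -[? ?] [? ?]; apply/andP; split; apply/andP.
apply: closedI; apply: closedI.
- case: (ba B) => [a|] /=; last exact: closed_true.
  by apply: closed_le_fun => //; exact: continuous_cst'.
- case: (bb B) => [a|] /=; last exact: closed_true.
  by apply: closed_le_fun => //; exact: continuous_cst'.
- exact: closed_geo.
- exact: closed_leo.
Qed.

Lemma ostrip_open B : open [set z : plane | ostrip B z.1].
Proof.
have -> : [set z : plane | ostrip B z.1] =
    [set z | gto (ba B) z.1] `&` [set z | lto (bb B) z.1].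
  by apply/seteqP; split => z /=; [move=> /andP[]|move=> ?; apply/andP].
apply: openI.
  case: (ba B) => [a|] /=; last exact: open_true.
  by apply: open_lt_fun => //; exact: continuous_cst'.
case: (bb B) => [a|] /=; last exact: open_true.
by apply: open_lt_fun => //; exact: continuous_cst'.
Qed.

Lemma cband_clamp B x y : bandwf B -> cstrip B x ->
  cband B (x, clampo (appo (bf B) x) (appo (bg B) x) y).
Proof.
move=> wB cx; rewrite /cband /= cx geo_clampo leo_clampo //; exact: band_ole.
Qed.

(** The approximating curve moves the abscissa into the open strip while the ordinate, clamped
    between the graphs, is pulled towards [mido]. *)
Lemma cband_closure B z : bandwf B -> cband B z -> closure (oband B) z.
Proof.
move=> wB /andP[cz /andP[fz gz]]; have [[x0 ox0] cf cg lt] := wB.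
pose x (d : R) := z.1 + d * (x0 - z.1).
pose c (d : R) := clampo (appo (bf B) (x d)) (appo (bg B) (x d)) z.2.
pose m (d : R) := mido (appo (bf B) (x d)) (appo (bg B) (x d)).
have cx : continuous x by exact: continuous_affine.
have x00 : x 0 = z.1 by rewrite /x mul0r addr0.
rewrite [z]surjective_pairing -x00.
have -> : z.2 = c 0 + 0 * (m 0 - c 0) by rewrite mul0r addr0 /c x00 clampo_id.
apply: (@closed_curve _ _ _ (fun d => (x d, c d + d * (m d - c d)))).
- exact: closed_closure.
- apply: continuous_pair' => //.
  have cc : continuous c.
    by apply: continuous_clampo => //; exact: continuous_cst'.
  apply: continuousD' => //; apply: continuousM'; first exact: continuous_id'.
  by apply: continuousB' => //; exact: continuous_mido.
exists 1 => // d d01; apply: subset_closure.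
have ox : ostrip B (x d) by apply: ostrip_convex => //; lra.
have lto_ := lt _ ox; rewrite /oband /= ox /=; apply/andP; split.
  apply: gto_convex; [lra|exact: geo_clampo|exact: gto_mido].
apply: lto_convex; [lra|exact/leo_clampo/oltW|exact: lto_mido].
Qed.

(** Points slide horizontally to the line over [a], their ordinates clamped between the graphs, and
    then move within that line. The clamp does not move points of the band already on the line, so
    the retraction is strong. *)
Lemma cband_treelike B : bandwf B -> treelike (cband B).
Proof.
move=> wB; have cB := cband_closed wB; have [_ cf cg _] := wB.
split => // K /vsegmentP[a [I [iI cI I0 ->]]] KB.
have ca : cstrip B a by have [y Iy] := I0; have /andP[] := KB (a, y) (conj erefl Iy).
pose J : set R := [set y | cband B (a, y)].
have JB : vert_line a J `<=` cband B.
  by move=> z [za]; rewrite /J /= -za -surjective_pairing.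
apply: (@strong_retract_trans _ _ (vert_line a J)) => //.
- by move=> z [za Iz]; split => //; apply: KB.
- pose x (q : plane * R) := q.1.1 + q.2 * (a - q.1.1).
  exists (fun q => (x q, clampo (appo (bf B) (x q)) (appo (bg B) (x q)) q.1.2)).
  have cq : continuous (fun q : plane * R => q.1).
    exact/continuous_fst'/continuous_id'.
  have cq1 : continuous (fun q : plane * R => q.1.1) by exact: continuous_fst'.
  have cq2 : continuous (fun q : plane * R => q.1.2) by exact: continuous_snd'.
  have cx : continuous x.
    apply: continuousD' => //; apply: continuousM'.
      exact/continuous_snd'/continuous_id'.
    by apply: continuousB' => //; exact: continuous_cst'.
  split.
  + apply: continuous_subspaceT; apply: continuous_pair' => //.
    exact: continuous_clampo.
  + move=> z s /andP[cz _] us; apply: cband_clamp => //.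
    exact: cstrip_convex.
  + move=> z /andP[_ /andP[fz gz]]; rewrite /x /= mul0r addr0 clampo_id //.
    by rewrite -surjective_pairing.
  + move=> z /andP[_ /andP[fz gz]]; rewrite /x /= mul1r addrC subrK.
    by split => //; exact: cband_clamp.
  + move=> z s [za /andP[_ /= /andP[fz gz]]] us.
    rewrite /x /= za subrr mulr0 addr0 clampo_id //.
    by rewrite -za -surjective_pairing.
- apply: vert_line_strong_retract => //.
    move=> y1 y2 /andP[h1 /andP[h2 h3]] /andP[_ /andP[h4 h5]] y hy.
    apply/and3P; split => //=; move: h2 h3 h4 h5 hy => /=.
      by case: (bf B) => [f|] //=; lra.
    by case: (bg B) => [f|] //=; lra.
  by move=> y Iy; apply: KB.
Qed.

End Bands.

(** * Decompositions into bands *)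

Section Phi.
Variables (R : realType) (p : {poly R}) (t : R).
Local Notation plane := (R * R)%type.
Implicit Types z w : plane.

Lemma Phi_continuous : continuous (Phi p t).
Proof.
have c1 : continuous (fun z : plane => z.1) by exact/continuous_fst'/continuous_id'.
have c2 : continuous (fun z : plane => z.2) by exact/continuous_snd'/continuous_id'.
have cc (a : R) : continuous (fun z : plane => a) by exact: continuous_cst'.
apply: continuousB'.
  apply: (@continuous_comp' _ _ _ (fun z : plane => z.1 * cos t + z.2 * sin t)
    (horner p)); last exact: continuous_horner.
  by apply: continuousD'; exact: continuousM'.
apply: continuousD'; last exact: continuousM'.
have -> : (fun z : plane => - z.1 * sin t) = (fun z => z.1 * - sin t).
  by apply/funext => z; rewrite mulNr mulrN.
exact: continuousM'.
Qed.

(* Along the normal direction [(- sin t, cos t)] the argument of [p] is constant. *)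
Lemma Phi_ray z (s : R) :
  Phi p t (z.1 - s * sin t, z.2 + s * cos t) = Phi p t z - s.
Proof.
rewrite /Phi /=; have := cos2Dsin2 t; set c := cos t; set d := sin t => cd.
have -> : (z.1 - s * d) * c + (z.2 + s * c) * d = z.1 * c + z.2 * d by ring.
have -> : - (z.1 - s * d) * d + (z.2 + s * c) * c =
    - z.1 * d + z.2 * c + s * (c ^+ 2 + d ^+ 2) by ring.
rewrite cd; ring.
Qed.

(** The line through [w] in the normal direction, as a graph over the abscissa; this is meaningful
    when [sin t] is not zero. *)
Definition ray w (x : R) : R := w.2 - (x - w.1) * (cos t / sin t).

Lemma ray_base w : ray w w.1 = w.2.
Proof. by rewrite /ray subrr mul0r subr0. Qed.

Lemma ray_continuous w : continuous (ray w).
Proof.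
apply: continuousB'; first exact: continuous_cst'.
apply: continuousM'; last exact: continuous_cst'.
by apply: continuousB'; [exact: continuous_id'|exact: continuous_cst'].
Qed.

(** The quotient is the time at which the ray from [w] reaches abscissa [x]. The ray goes left when
    [sin t] is positive and right when it is negative. *)
Lemma Phi_ray_lt0 w x : Phi p t w <= 0 -> 0 < (w.1 - x) / sin t ->
  Phi p t (x, ray w x) < 0.
Proof.
move=> w0 s0; have t0 : sin t != 0.
  by apply: contraTneq s0 => ->; rewrite invr0 mulr0 ltxx.
have := Phi_ray w ((w.1 - x) / sin t).
rewrite divfK // opprB addrC subrK /ray => E.
rewrite (_ : w.2 - _ = w.2 + (w.1 - x) / sin t * cos t); last by field.
rewrite E; lra.
Qed.

Lemma sin0_cos : sin t = 0 -> cos t = 1 \/ cos t = -1.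
Proof.
move=> s0; have := cos2Dsin2 t; rewrite s0 expr0n /= addr0 => /eqP.
by rewrite sqrf_eq1 => /orP[] /eqP; [left|right].
Qed.

End Phi.

Lemma IVT_sign (R : realType) (h : R -> R) (x y : R) : continuous h -> x <= y ->
  (forall s, x <= s <= y -> h s != 0) -> (h x < 0) = (h y < 0).
Proof.
move=> ch xy hn.
have hx : h x != 0 by apply: hn; rewrite lexx.
have hy : h y != 0 by apply: hn; rewrite lexx xy.
have aux : Num.min (h x) (h y) <= 0 <= Num.max (h x) (h y) -> False.
  move=> /(IVT xy (continuous_subspaceT ch))[s]; rewrite in_itv /= => hs /eqP.
  by rewrite (negbTE (hn _ hs)).
have [hx0|hx0] := ltP (h x) 0; have [hy0|hy0] := ltP (h y) 0 => //; exfalso; apply: aux.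
- by rewrite ge_min le_max (ltW hx0) hy0 orbT.
- by rewrite ge_min le_max (ltW hy0) hx0 orbT.
Qed.

Lemma connected_meets_graph (R : realType) (D : set (R * R)) (L : R -> R) u v :
  connected D -> continuous L -> D u -> D v -> u.2 <= L u.1 -> L v.1 <= v.2 ->
  exists2 z, D z & z.2 = L z.1.
Proof.
move=> cD cL Du Dv uL Lv; pose h (z : R * R) := z.2 - L z.1.
have ch : continuous h.
  apply: continuousB'; first exact/continuous_snd'/continuous_id'.
  by apply: continuous_comp' cL; exact/continuous_fst'/continuous_id'.
have /connected_intervalP iD :=
  connected_continuous_connected cD (continuous_subspaceT ch).
have [|||z Dz hz] := iD (h u) (h v) _ _ 0.
- by exists u.
- by exists v.
- by rewrite /h subr_le0 uL subr_ge0.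
by exists z => //; apply/eqP; rewrite -subr_eq0 -hz.
Qed.

Lemma filter_forall_lt (T : Type) (F : set_system T) (n : nat)
    (P : nat -> set T) : Filter F ->
  (forall i, (i < n)%N -> F (P i)) -> F [set z | forall i, (i < n)%N -> P i z].
Proof.
move=> FF; elim: n => [_|n IH h]; first by apply: filterE => z i.
have h1 := IH (fun i ni => h i (ltnW ni)).
apply: filterS (filterI h1 (h n (ltnSn n))) => z [hz Pn] i.
by rewrite ltnS leq_eqVlt => /orP[/eqP ->|/hz].
Qed.

Section Decomposition.
Variables (R : realType) (k : nat) (p : nat -> {poly R}) (t : nat -> R).
Local Notation plane := (R * R)%type.
Local Notation Ph i := (Phi (p i) (t i)).
Local Notation X := (\bigcap_(i in `I_k) poly_half_plane (p i) (t i)).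

Definition on_graph (B : band R) (f : R -> R) :=
  exists2 i, (i < k)%N & forall x, cstrip B x -> Ph i (x, f x) = 0.

(** Equality has to be allowed because neighbouring cells share an arc; [below_strict] excludes it
    afterwards. *)
Definition below (B : band R) (g f : R -> R) :=
  (forall x, ostrip B x -> g x < f x) \/ (forall x, g x = f x).

Definition before (B B' : band R) :=
  (exists r r', [/\ bb B = Some r, ba B' = Some r' & r <= r']) \/
  [/\ ba B = ba B', bb B = bb B' & exists g f,
     [/\ bg B = Some g, bf B' = Some f & below B g f]].

(** The cover is by closed bands because points of [X] may lie on the cutting lines, which the open
    bands miss. *)
Record decomposition (N : nat) (b : nat -> band R) : Prop := {
  dec_wf : forall n, (n < N)%N -> bandwf (b n);
  dec_bf : forall n f, (n < N)%N -> bf (b n) = Some f -> on_graph (b n) f;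
  dec_bg : forall n f, (n < N)%N -> bg (b n) = Some f -> on_graph (b n) f;
  dec_oband : forall n, (n < N)%N -> oband (b n) `<=` X;
  dec_before : forall m n, (m < n)%N -> (n < N)%N -> before (b m) (b n);
  dec_cover : forall z, X z -> exists2 n, (n < N)%N & cband (b n) z }.

Variables (N : nat) (b : nat -> band R).
Definition bunion n : set plane := [set z | exists2 m, (m < n)%N & cband (b m) z].

Lemma bunionS n : bunion n.+1 = cband (b n) `|` bunion n.
Proof.
apply/seteqP; split => z.
  case=> m; rewrite ltnS leq_eqVlt => /orP[/eqP ->|mn] h; first by left.
  by right; exists m.
case=> [h|[m mn h]]; first by exists n.
by exists m => //; exact: ltnW.
Qed.

Lemma closed_bunion n : (forall m, (m < n)%N -> bandwf (b m)) -> closed (bunion n).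
Proof.
elim: n => [_|n IH wf].
  rewrite (_ : bunion 0 = set0); first exact: closed0.
  by apply/seteqP; split => z //= [].
rewrite bunionS; apply: closedU; first by apply: cband_closed; exact: wf.
by apply: IH => m mn; apply: wf; exact: ltnW.
Qed.

Hypothesis decb : decomposition N b.

Lemma bunion_closed n : (n <= N)%N -> closed (bunion n).
Proof.
move=> nN; apply: closed_bunion => m mn; apply: (dec_wf decb).
exact: leq_trans nN.
Qed.

Lemma X_open : open X.
Proof.
rewrite openE => z Xz; rewrite /interior.
have h i : (i < k)%N -> nbhs z [set z' | 0 < Ph i z'].
  move=> ik; apply: open_nbhs_nbhs; split; last exact: (Xz i).
  by apply: open_lt_fun; [exact: continuous_cst'|exact: Phi_continuous].
have -> : X = [set z' | forall i, (i < k)%N -> 0 < Ph i z'].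
  by apply/seteqP; split => z'.
exact: (@filter_forall_lt _ _ k (fun i => [set z' | 0 < Ph i z'])).
Qed.

Lemma cband_Phi_ge0 n i z : (n < N)%N -> (i < k)%N -> cband (b n) z -> 0 <= Ph i z.
Proof.
move=> nN ik /(cband_closure (dec_wf decb nN)).
have cl : closed [set z | 0 <= Ph i z].
  by apply: closed_le_fun; [exact: continuous_cst'|exact: Phi_continuous].
move=> cz; apply: cl; apply: closure_subset cz => w /(dec_oband decb nN) Xw.
exact/ltW/(Xw i).
Qed.

Lemma bunion_Phi_ge0 n i z : (n <= N)%N -> (i < k)%N -> bunion n z -> 0 <= Ph i z.
Proof. by move=> nN ik [m mn]; apply: cband_Phi_ge0 => //; exact: leq_trans nN. Qed.

(** A small step [d] along the normal stays in the union, where [Phi] is nonnegative, and lowers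
    [Phi] by exactly [d]; hence [Phi] is at least [d] at [z]. *)
Lemma nbhs_bunion_X z : nbhs z (bunion N) -> X z.
Proof.
move=> nz i ik /=.
pose e (s : R) := (z.1 - s * sin (t i), z.2 + s * cos (t i)).
have ce : continuous e.
  have cc (a : R) : continuous (fun s : R => a) by exact: continuous_cst'.
  have cs (a : R) : continuous (fun s : R => s * a).
    by apply: continuousM' => //; exact: continuous_id'.
  by apply: continuous_pair'; [exact: continuousB'|exact: continuousD'].
have e0 : e 0 = z by rewrite /e !mul0r subr0 addr0 -surjective_pairing.
have : nbhs (0 : R) (e @^-1` bunion N) by apply: ce; rewrite e0.
move=> /nbhs_right_exists[d d0 /(_ d)]; rewrite lexx ltW // add0r => /(_ isT)[We _].
have := bunion_Phi_ge0 (leqnn _) ik We.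
rewrite /e Phi_ray /poly_half_plane /=; lra.
Qed.

Lemma not_X z : ~ X z -> exists2 i, (i < k)%N & Ph i z <= 0.
Proof.
move=> nX; apply: contrapT => h; apply: nX => i ik /=.
by rewrite /poly_half_plane /= ltNge; apply/negP => hi; apply: h; exists i.
Qed.

Lemma before_cstrip m n z : (m < n)%N -> (n < N)%N -> cband (b n) z ->
  geo (ba (b m)) z.1.
Proof.
move=> mn nN /andP[/andP[az bz] _].
have mN := ltn_trans mn nN.
have [[x0 /andP[ax bx]] _ _ _] := dec_wf decb mN.
have [[r [r' [Er Er' rr']]]|[Ea _ _]] := dec_before decb mn nN; last by rewrite Ea.
move: az bx; rewrite Er Er' /=; case: (ba (b m)) ax => //= a; lra.
Qed.

(** If the graphs coincided, the two bands would together fill a neighbourhood of [(x, f x)]. This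
    point would then be in [X], although some [Phi] vanishes on the graph of [f] there. *)
Lemma below_strict m n g f x : (m < n)%N -> (n < N)%N ->
  ba (b m) = ba (b n) -> bb (b m) = bb (b n) ->
  bg (b m) = Some g -> bf (b n) = Some f -> below (b m) g f ->
  ostrip (b n) x -> g x < f x.
Proof.
move=> mn nN Ea Eb Eg Ef [h|h] ox.
  by apply: h; move: ox; rewrite /ostrip Ea Eb.
exfalso; have mN := ltn_trans mn nN.
have [_ cmf cmg ltm] := dec_wf decb mN.
have [_ cnf cng ltn] := dec_wf decb nN.
have oxm : ostrip (b m) x by move: ox; rewrite /ostrip Ea Eb.
have c1 : continuous (fun z : plane => z.1) by exact/continuous_fst'/continuous_id'.
have c2 : continuous (fun z : plane => z.2) by exact/continuous_snd'/continuous_id'.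
have Xx : X (x, f x).
  apply: nbhs_bunion_X.
  have n1 : nbhs (x, f x) [set z | ostrip (b n) z.1].
    by apply: open_nbhs_nbhs; split => //; exact: ostrip_open.
  have n2 : nbhs (x, f x) [set z | gto (appo (bf (b m)) z.1) z.2].
    apply: open_nbhs_nbhs; split; first exact: open_gto.
    by move: (ltm _ oxm); rewrite Eg /= h; case: (bf (b m)).
  have n3 : nbhs (x, f x) [set z | lto (appo (bg (b n)) z.1) z.2].
    apply: open_nbhs_nbhs; split; first exact: open_lto.
    by move: (ltn _ ox); rewrite Ef /=; case: (bg (b n)).
  near=> z.
  have oz : ostrip (b n) z.1 by near: z.
  have [fz|zf] := leP (f z.1) z.2.
    exists n => //; apply/and3P; split; first exact: ostripW.
      by rewrite Ef.
    by apply: ltoW; near: z.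
  exists m => //; apply/and3P; split.
  - by have := ostripW oz; rewrite /cstrip Ea Eb.
  - by apply: gtoW; near: z.
  - by rewrite Eg /= h ltW.
have [i ik hi] := dec_bf decb nN Ef.
by have := Xx i ik; rewrite /= /poly_half_plane /= hi ?ltxx //; exact: ostripW.
Unshelve. all: by end_near. Qed.

Lemma below_le m n g f x : (m < n)%N -> (n < N)%N ->
  ba (b m) = ba (b n) -> bb (b m) = bb (b n) ->
  bg (b m) = Some g -> bf (b n) = Some f -> below (b m) g f ->
  cstrip (b n) x -> g x <= f x.
Proof.
move=> mn nN Ea Eb Eg Ef bl; have mN := ltn_trans mn nN.
have [ne cf _ _] := dec_wf decb nN; have [_ _ cg _] := dec_wf decb mN.
apply: (@cstrip_closed_prop _ _ [set x | g x <= f x]) => //.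
  by apply: closed_le_fun; [move: cg; rewrite Eg|move: cf; rewrite Ef].
by move=> y oy; apply/ltW/(below_strict mn nN Ea Eb).
Qed.

Lemma earlier_band_cases m n z : (m < n)%N -> (n < N)%N ->
  cband (b m) z -> cstrip (b n) z.1 ->
  ba (b n) = Some z.1 \/
  [/\ ba (b m) = ba (b n), bb (b m) = bb (b n) & exists g f,
    [/\ bg (b m) = Some g, bf (b n) = Some f, below (b m) g f
      & z.2 <= g z.1 <= f z.1]].
Proof.
move=> mn nN /andP[/andP[_ zr] /andP[_ zg]] /[dup] cz /andP[r'z _].
have [[r [r' [Er Er' rr']]]|[Ea Eb [g [f [Eg Ef bl]]]]] := dec_before decb mn nN.
  left; rewrite Er'; congr Some; move: zr r'z; rewrite Er Er' /=; lra.
right; split => //; exists g, f; split => //.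
move: zg; rewrite Eg /= => -> /=; exact: (below_le mn nN Ea Eb).
Qed.

End Decomposition.

(** * The left-to-right sweep *)

Section Sweep.
Variables (R : realType) (k : nat) (p : nat -> {poly R}) (t : nat -> R).
Local Notation plane := (R * R)%type.
Local Notation Ph i := (Phi (p i) (t i)).
Local Notation X := (\bigcap_(i in `I_k) poly_half_plane (p i) (t i)).
Variables (N : nat) (b : nat -> band R).
Hypothesis decb : decomposition k p t N b.

Lemma earlier_band_right m n z : (m < n)%N -> (n < N)%N ->
  cband (b m) z -> gto (ba (b n)) z.1 -> cstrip (b n) z.1.
Proof.
move=> mn nN /andP[/andP[az zb] _] nz.
have [[r [r' [Er Er' rr']]]|[Ea Eb _]] := dec_before decb mn nN.
  by exfalso; move: zb nz; rewrite Er Er' /=; lra.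
by rewrite /cstrip -Ea -Eb az.
Qed.

(** The point [w] is a gap in the left side between [u] and [v], and [D] would join these around it.
    The ray from [w] along which some [Phi] is negative leaves no room for this. *)
Lemma left_side_separation n (a : R) u v w D : (n < N)%N ->
  ba (b n) = Some a -> cband (b n) u -> cband (b n) v ->
  u.1 = a -> v.1 = a -> w.1 = a -> u.2 < w.2 < v.2 -> ~ bunion b n w ->
  connected D -> D `<=` bunion b n -> D u -> D v -> False.
Proof.
move=> nN Ea Bu Bv ua va wa /andP[uw wv] nYw cD DY Du Dv.
have wfn := dec_wf decb nN; have [_ cf cg lt] := wfn.
have fu : geo (appo (bf (b n)) a) u.2 by case/and3P: Bu => _; rewrite ua.
have gv : leo (appo (bg (b n)) a) v.2 by case/and3P: Bv => _ _; rewrite va.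
(* Otherwise points just left of [w] would be in [X] but in no band: the union of the earlier bands
   is closed and misses [w], and the other bands lie over abscissas at least [a]. *)
have nXw : ~ X w.
  move=> Xw; pose e (s : R) := (w.1 + s, w.2).
  have ce : continuous e.
    apply: continuous_pair'; last exact: cst_continuous.
    by apply: continuousD'; [exact: continuous_cst'|exact: continuous_id'].
  have e0 : e 0 = w by rewrite /e addr0 -surjective_pairing.
  have nX : nbhs (0 : R) (e @^-1` X).
    by apply: ce; rewrite e0; apply: open_nbhs_nbhs; split => //; exact: X_open.
  have nY : nbhs (0 : R) (e @^-1` (~` bunion b n)).
    apply: ce; rewrite e0; apply: open_nbhs_nbhs; split => //.
    by apply: closed_openC; apply: (bunion_closed decb); exact: ltnW.
  have [d d0 /(_ d)] := nbhs_right_exists (filterI nX nY).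
  rewrite lexx ltW // add0r sub0r => /(_ isT)[_ [Xe nYe]].
  have [m mN Bm] := dec_cover decb Xe.
  suff mn : (m < n)%N by apply: nYe; exists m.
  rewrite ltnNge leq_eqVlt; apply/negP => /orP[/eqP nm|nm].
    by move: Bm; rewrite -nm => /andP[/andP[+ _] _]; rewrite Ea /= wa; lra.
  by have := before_cstrip decb nm mN Bm; rewrite Ea /= wa; lra.
have [i ik hi] := not_X nXw.
have noB z : Ph i z < 0 -> cband (b n) z -> False.
  by move=> z0 /(cband_Phi_ge0 decb nN ik); rewrite leNgt z0.
have [s0|s0|s0] := ltgtP (sin (t i)) 0.
- (* The ray enters [b n] to the right of [w]. *)
  pose r := ray (t i) w.
  have cr : continuous r by exact: ray_continuous.
  have ra : r a = w.2 by rewrite /r -wa ray_base.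
  have n1 : nbhs a [set x | gto (appo (bf (b n)) x) (r x)].
    apply: open_nbhs_nbhs; split; first by apply: open_gto => //; exact: continuous_id'.
    by rewrite /= ra; move: fu; case: (bf (b n)) => //= f; lra.
  have n2 : nbhs a [set x | lto (appo (bg (b n)) x) (r x)].
    apply: open_nbhs_nbhs; split; first by apply: open_lto => //; exact: continuous_id'.
    by rewrite /= ra; move: gv; case: (bg (b n)) => //= f; lra.
  have n3 : nbhs a [set x | lto (bb (b n)) x].
    have [[x0 /andP[ax xb]] _ _ _] := wfn.
    case E : (bb (b n)) xb => [b'|] /= xb; last exact: filterE.
    apply: open_nbhs_nbhs; split => /=.
      by apply: open_lt_fun; [exact: continuous_id'|exact: continuous_cst'].
    by move: ax; rewrite Ea /=; lra.
  have [d d0 /(_ d)] := nbhs_right_exists (filterI n1 (filterI n2 n3)).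
  rewrite lexx ltW // => /(_ isT)[[h1 [h2 h3]] _].
  apply: (noB (a + d, r (a + d))).
    apply: Phi_ray_lt0 => //; rewrite wa opprD addrA subrr sub0r mulNr -mulrN -invrN.
    by rewrite divr_gt0 // oppr_gt0.
  by rewrite /cband /cstrip /= Ea /= gtoW // !ltoW // lerDl ltW.
(* The ray goes left. [L] follows it up to [a] and then the lower graph of [b n] translated so as to
   pass through [w], hence strictly above that graph. Earlier bands over this strip stay below the
   graph, and [w] itself is missing from the union, so [D] cannot meet [L]. *)
- pose F := if bf (b n) is Some f then f else fun=> 0.
  pose L x := ray (t i) w (Num.min x a) + (F (Num.max x a) - F a).
  have cF : continuous F.
    by rewrite /F; case: (bf (b n)) cf => // _; exact: continuous_cst'.
  have cL : continuous L.
    have cc (c : R) : continuous (fun x : R => c) by exact: continuous_cst'.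
    have ci : continuous (fun x : R => x) by exact: continuous_id'.
    apply: continuousD'.
      apply: (@continuous_comp' _ _ _ (fun x => Num.min x a) (ray (t i) w)).
        exact: continuous_minr.
      exact: ray_continuous.
    apply: continuousB' => //.
    by apply: (@continuous_comp' _ _ _ (fun x => Num.max x a) F) => //; exact: continuous_maxr.
  have La : L a = w.2.
    by rewrite /L minxx maxxx subrr addr0 -wa ray_base.
  have [||z Dz zL] := connected_meets_graph cD cL Du Dv.
  + by rewrite ua La ltW.
  + by rewrite va La ltW.
  have Yz := DY _ Dz; have [m mn Bm] := Yz.
  have [za|za|za] := ltgtP z.1 a.
  + have : 0 <= Ph i z by apply: (bunion_Phi_ge0 decb _ ik Yz); exact: ltnW.
    apply/negP; rewrite -ltNge [z]surjective_pairing zL /L.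
    rewrite (min_idPl (ltW za)) (max_idPr (ltW za)) subrr addr0.
    by apply: Phi_ray_lt0 => //; rewrite wa divr_gt0 // subr_gt0.
  + have cz : cstrip (b n) z.1.
      by apply: (earlier_band_right mn nN Bm); rewrite Ea.
    have [|[_ _ [g [f [_ Ef _ /andP[zg gf]]]]]] := earlier_band_cases decb mn nN Bm cz.
      by rewrite Ea => -[] az; move: za; rewrite az ltxx.
    move: fu; rewrite Ef /= => fu.
    move: zL; rewrite /L /F Ef (min_idPr (ltW za)) (max_idPl (ltW za)).
    by rewrite -{1}wa ray_base; lra.
  + apply: nYw; suff -> : w = z by [].
    by rewrite [w]surjective_pairing wa -La -za -zL -surjective_pairing.
(* A vertical ray runs into [v] or into [u], both in [b n]. *)
- have [c1|c1] := sin0_cos s0.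
  + apply: (noB v) => //; have := Phi_ray (p i) (t i) w (v.2 - w.2).
    rewrite s0 c1 mulr0 mulr1 subr0 addrC subrK wa -va -surjective_pairing => ->.
    by lra.
  + apply: (noB u) => //; have := Phi_ray (p i) (t i) w (w.2 - u.2).
    rewrite s0 c1 mulr0 mulrN1 subr0 opprB addrC subrK wa -ua -surjective_pairing => ->.
    by lra.
Qed.

(** Below the new band there is a gap between its lower graph [f] and the upper graph [g'] of the
    earlier band; it is pinched at [v], and [D] would close it on the left. The ray from the point
    of [f] over the middle of the strip then has nowhere to go. *)
Lemma right_corner_separation n m (a c : R) u v D : (n < N)%N -> (m < n)%N ->
  ba (b n) = Some a -> bb (b n) = Some c -> cband (b n) u -> cband (b n) v ->
  u.1 = a -> v.1 = c -> cband (b m) v ->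
  connected D -> D `<=` bunion b n -> D u -> D v -> False.
Proof.
move=> nN mn Ea Eb Bu Bv ua vc Bmv cD DY Du Dv.
have mN := ltn_trans mn nN.
have wfn := dec_wf decb nN; have [[x0 ox0] cf cg lt] := wfn.
have ac : a < c by move: ox0; rewrite /ostrip Ea Eb /=; lra.
have csn x : cstrip (b n) x = (a <= x <= c) by rewrite /cstrip Ea Eb.
have cv : cstrip (b n) v.1 by case/andP: Bv.
have [|[Eam Ebm [g' [f [Eg' Ef bl /andP[vg' g'f]]]]]] :=
    earlier_band_cases decb mn nN Bmv cv.
  by rewrite Ea vc => -[] ?; move: ac; lra.
have fv : f c <= v.2 by move/and3P: Bv => [_ + _]; rewrite Ef vc.
rewrite vc in vg' g'f.
pose x' := (a + c) / 2.
have ox' : ostrip (b n) x' by rewrite /ostrip Ea Eb /= /x'; lra.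
have ax' : a < x' by rewrite /x'; lra.
have xc' : x' < c by rewrite /x'; lra.
have [i ik hi] := dec_bf decb nN Ef.
pose w := (x', f x').
have w0 : Ph i w = 0 by apply: hi; exact: ostripW.
have g'fx : g' x' < f x' by exact: (below_strict decb mn nN Eam Ebm).
have {}cf : continuous f by move: cf; rewrite Ef.
have cg' : continuous g' by have [_ _ + _] := dec_wf decb mN; rewrite Eg'.
(* A lid inside the closed band; if there is no upper graph, [f x + 1] serves. *)
pose M := if bg (b n) is Some g then g else fun x => f x + 1.
have cM : continuous M.
  rewrite /M; case: (bg (b n)) cg => // _.
  by apply: continuousD' => //; exact: continuous_cst'.
have BM x : cstrip (b n) x -> cband (b n) (x, M x).
  move=> cx; have := band_ole wfn cx; rewrite /cband /= cx Ef /= /M.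
  by case: (bg (b n)) => [g|] /=; [rewrite lexx andbT|rewrite lerDl ler01].
have Bn x y : cstrip (b n) x -> f x <= y -> y < M x -> cband (b n) (x, y).
  move=> cx fy yM; rewrite /cband /= cx Ef /= fy /=.
  by move: yM; rewrite /M; case: (bg (b n)) => [g|] //=; exact: ltW.
have fM : f x' < M x'.
  have := lt _ ox'; rewrite Ef /M; case: (bg (b n)) => [g|] //= _.
  by rewrite ltrDl ltr01.
have Bg' x : cstrip (b n) x -> cband (b m) (x, g' x).
  move=> cx; have cxm : cstrip (b m) x by move: cx; rewrite /cstrip Eam Ebm.
  have := band_ole (dec_wf decb mN) cxm; rewrite /cband /= cxm Eg' /= lexx andbT.
  by case: (bf (b m)).
have noB j z : (j < N)%N -> Ph i z < 0 -> cband (b j) z -> False.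
  by move=> jN z0 /(cband_Phi_ge0 decb jN ik); rewrite leNgt z0.
pose r := ray (t i) w.
have cr : continuous r by exact: ray_continuous.
have rx' : r x' = f x' by rewrite /r (ray_base (t i) w).
have rP x : 0 < (x' - x) / sin (t i) -> Ph i (x, r x) < 0.
  by move=> h; apply: Phi_ray_lt0 => //; rewrite w0.
have crM : continuous (fun x => r x - M x) by exact: continuousB'.
have crg : continuous (fun x => r x - g' x) by exact: continuousB'.
have rM x : cstrip (b n) x -> 0 < (x' - x) / sin (t i) -> r x - M x != 0.
  move=> cx h; rewrite subr_eq0; apply/eqP => E.
  by apply: (noB n (x, r x) nN (rP _ h)); rewrite E; exact: BM.
have rMx' : r x' - M x' < 0 by rewrite rx' subr_lt0.
have [s0|s0|s0] := ltgtP (sin (t i)) 0.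
(* The ray goes right and can cross neither [M] nor [g']. Over [c] it is then at least [g' c], which
   is at least [f c], and below [M c], so it has entered [b n]. *)
- have dpos x : x' < x -> 0 < (x' - x) / sin (t i).
    by move=> h; rewrite ltr_ndivlMr // mul0r subr_lt0.
  have cstr x : x' <= x <= c -> cstrip (b n) x by rewrite csn; lra.
  have rMc : r c < M c.
    rewrite -subr_lt0 -(IVT_sign crM (ltW xc')) // => x hx.
    have [<-|xx'] := eqVneq x' x; first by rewrite lt_eqF.
    by apply: rM; [exact: cstr|apply: dpos; rewrite lt_neqAle xx'; case/andP: hx].
  have rgc : ~~ (r c - g' c < 0).
    rewrite -(IVT_sign crg (ltW xc')); first by rewrite rx' -leNgt subr_ge0 ltW.
    move=> x hx; have [<-|xx'] := eqVneq x' x.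
      by rewrite rx' subr_eq0 gt_eqF.
    rewrite subr_eq0; apply/eqP => E.
    apply: (noB m (x, r x) mN); last by rewrite E; exact/Bg'/cstr.
    by apply/rP/dpos; rewrite lt_neqAle xx'; case/andP: hx.
  apply: (noB n (c, r c) nN); first by apply/rP/dpos.
  apply: Bn => //; first by rewrite csn lexx ltW.
  by move: rgc; rewrite -leNgt subr_ge0; lra.
(* The ray goes left. Over [a] it must be below [f a], hence below [u], as otherwise it would have
   entered [b n]. *)
- have dpos x : x < x' -> 0 < (x' - x) / sin (t i).
    by move=> h; rewrite divr_gt0 // subr_gt0.
  have rMa : r a < M a.
    rewrite -subr_lt0 (IVT_sign crM (ltW ax')) // => x hx.
    have [->|xx'] := eqVneq x x'; first by rewrite lt_eqF.
    apply: rM; first by rewrite csn; lra.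
    by apply: dpos; rewrite lt_neqAle xx'; case/andP: hx.
  have raf : r a < f a.
    rewrite ltNge; apply/negP => far; apply: (noB n (a, r a) nN).
      by apply/rP/dpos.
    by apply: Bn => //; rewrite csn lexx ltW.
  have fu : f a <= u.2 by move/and3P: Bu => [_ + _]; rewrite Ef ua.
  (* The barrier follows the ray up to [x'] and then [f] plus a term of slope one. This lifts it
     strictly above [v], so that it is not met at [v] itself; at [x'] it is not met because earlier
     bands stay strictly below [f] over the open strip. *)
  pose L x := r (Num.min x x') + (f (Num.max x x') - f x') + (Num.max x x' - x').
  have cL : continuous L.
    have cc (e : R) : continuous (fun x : R => e) by exact: continuous_cst'.
    have ci : continuous (fun x : R => x) by exact: continuous_id'.
    have cmax : continuous (fun x => Num.max x x') by exact: continuous_maxr.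
    apply: continuousD'; last exact: continuousB'.
    apply: continuousD'.
      apply: (@continuous_comp' _ _ _ (fun x => Num.min x x') r) => //.
      exact: continuous_minr.
    apply: continuousB' => //.
    exact: (@continuous_comp' _ _ _ (fun x => Num.max x x') f).
  have Lright x : x' <= x -> L x = f x + (x - x').
    by move=> xx'; rewrite /L (min_idPr xx') (max_idPl xx') rx'; lra.
  have Lleft x : x <= x' -> L x = r x.
    by move=> xx'; rewrite /L (min_idPl xx') (max_idPr xx'); lra.
  have [||z Dz zL] := connected_meets_graph cD cL Dv Du.
  + by rewrite vc Lright ?ltW //; lra.
  + by rewrite ua Lleft ?ltW //; lra.
  have Yz := DY _ Dz; have [m2 mn2 Bm2] := Yz.
  have [zx|zx] := ltP z.1 x'.
    apply: (noB m2 z (ltn_trans mn2 nN)) => //.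
    rewrite [z]surjective_pairing zL Lleft ?ltW //; exact/rP/dpos.
  have cz : cstrip (b n) z.1.
    by apply: (earlier_band_right mn2 nN Bm2); rewrite Ea /=; lra.
  have [|[Ea2 Eb2 [g2 [f2 [Eg2 Ef2 bl2 /andP[zg gf]]]]]] :=
      earlier_band_cases decb mn2 nN Bm2 cz.
    by rewrite Ea => -[] az; move: ax'; rewrite az ltNge zx.
  have ff : f2 = f by move: Ef2; rewrite Ef => -[].
  rewrite Lright // in zL; rewrite ff in gf Ef2 bl2.
  have zx' : z.1 = x' by apply/eqP; rewrite eq_le zx andbT; lra.
  have := below_strict decb mn2 nN Ea2 Eb2 Eg2 Ef2 bl2 ox'.
  by rewrite -zx'; lra.
- have [c1|c1] := sin0_cos s0.
  + apply: (noB n (x', M x') nN); last exact/BM/ostripW.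
    have := Phi_ray (p i) (t i) w (M x' - f x').
    rewrite s0 c1 mulr0 mulr1 subr0 /= addrC subrK => ->.
    by rewrite w0; lra.
  + apply: (noB m (x', g' x') mN); last exact/Bg'/ostripW.
    have := Phi_ray (p i) (t i) w (f x' - g' x').
    rewrite s0 c1 mulr0 mulrN1 subr0 opprB /= addrC subrK => ->.
    by rewrite w0; lra.
Qed.

(** Over the open strip earlier bands stay strictly below the new one, so contact is confined to the
    left side and the lower right corner. *)
Lemma earlier_contact n z : (n < N)%N -> bunion b n z -> cband (b n) z ->
  ba (b n) = Some z.1 \/
  (bb (b n) = Some z.1 /\ exists2 f, bf (b n) = Some f & z.2 = f z.1).
Proof.
move=> nN [m mn Bm] /[dup] Bn /and3P[cz fz _].
have [|[Ea Eb [g [f [Eg Ef bl /andP[zg gf]]]]]] := earlier_band_cases decb mn nN Bm cz.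
  by left.
have zf : z.2 = f z.1 by move: fz; rewrite Ef /=; lra.
have [oz|noz] := boolP (ostrip (b n) z.1).
  exfalso; have := below_strict decb mn nN Ea Eb Eg Ef bl oz.
  by move: zg; rewrite zf; lra.
move: noz cz; rewrite /ostrip /cstrip negb_and => /orP[na|nb] /andP[az bz].
  left; case: (ba (b n)) na az => //= a na az.
  by congr Some; apply/eqP; rewrite eq_le az leNgt na.
right; split; last by exists f.
case: (bb (b n)) nb bz => //= c nc cz.
by congr Some; apply/eqP; rewrite eq_le cz leNgt nc.
Qed.

(** Two linked points on the left side have no gap between them; a point of the left side and the
    right corner cannot be linked; two right corners are the same point. *)
Lemma cband_attach n u v : (n < N)%N -> cband (b n) u -> cband (b n) v ->
  linked (bunion b n) u v -> u.1 = v.1 /\ vseg u v `<=` bunion b n `&` cband (b n).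
Proof.
move=> nN Bu Bv [D [cD DY Du Dv]].
have [Yu Yv] := (DY _ Du, DY _ Dv).
have pair_eq (z w : plane) : z.1 = w.1 -> z.2 = w.2 -> z = w.
  by case: z w => [? ?] [? ?] /= -> ->.
have conv w : u.1 = v.1 -> vseg u v w -> cband (b n) w.
  move=> uv [wu /andP[uw wv]]; move: Bu Bv => /and3P[cu fu _] /and3P[_ _ gv].
  rewrite /cband /= wu cu /=; apply/andP; split.
    by case: (bf (b n)) fu => //= f fu; exact: le_trans uw.
  by rewrite uv; case: (bg (b n)) gv => //= g gv; exact: le_trans gv.
case: (earlier_contact nN Yu Bu) => [Ea|[Eb [f Ef uf]]];
  case: (earlier_contact nN Yv Bv) => [Ea'|[Eb' [f' Ef' vf]]].
- have uv : u.1 = v.1 by move: Ea'; rewrite Ea => -[].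
  split => // w hw; split; last exact: conv.
  have [wu /andP[uw wv]] := hw.
  have [E|nuw] := eqVneq u.2 w.2; first by rewrite -(pair_eq u w).
  have [E|nwv] := eqVneq w.2 v.2; first by rewrite (pair_eq w v) // wu.
  apply: contrapT => nYw.
  apply: (@left_side_separation n u.1 u v w D) => //.
  by rewrite !lt_neqAle nuw uw nwv wv.
- have [m mn Bm] := Yv.
  by have := @right_corner_separation n m _ _ u v D nN mn Ea Eb' Bu Bv erefl erefl Bm cD DY Du Dv.
- have [m mn Bm] := Yu.
  by have := @right_corner_separation n m _ _ v u D nN mn Ea' Eb Bv Bu erefl erefl Bm cD DY Dv Du.
- have uv : u.1 = v.1 by move: Eb'; rewrite Eb => -[].
  have uv2 : u.2 = v.2 by move: Ef'; rewrite uf vf Ef uv => -[->].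
  split => // w [wu hw]; rewrite (pair_eq w u) //; move: hw; rewrite uv2; lra.
Qed.

Lemma bunion_forest : forest (bunion b N).
Proof.
suff h n : (n <= N)%N -> forest (bunion b n) by exact: h.
elim: n => [_|n IH nN].
  rewrite (_ : bunion b 0 = set0); first exact: forest0.
  by apply/seteqP; split => z //= [].
rewrite bunionS; apply: forest_attach; first by apply: IH; exact: ltnW.
  by apply: cband_treelike; exact: (dec_wf decb).
by move=> u v; exact: cband_attach.
Qed.

End Sweep.

(** * Components are regions of type I *)

Lemma convex_gt (R : realType) (a x y s : R) : 0 <= s <= 1 ->
  a < x -> a < y -> a < x + s * (y - x).
Proof.
move=> s01 ax ay; have [xy|yx] := leP x y.
  by apply: lt_le_trans ax _; nra.
by apply: lt_le_trans ay _; nra.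
Qed.

Lemma convex_lt (R : realType) (a x y s : R) : 0 <= s <= 1 ->
  x < a -> y < a -> x + s * (y - x) < a.
Proof.
move=> s01 xa ya; have := @convex_gt R (- a) (- x) (- y) s s01.
rewrite !ltrN2 => /(_ xa ya); lra.
Qed.

(** * Finite unions of sides *)

Section FiniteSides.
Variable R : realType.
Local Notation plane := (R * R)%type.
Implicit Types A Z : set plane.

Definition finite_sides Z := exists (n : nat) (A : nat -> set plane),
  (forall i, (i < n)%N -> is_side (A i)) /\ Z = \bigcup_(i in `I_n) A i.

Lemma finite_sides0 : finite_sides set0.
Proof. by exists 0%N, (fun=> set0); split => //; rewrite II0 bigcup_set0. Qed.

Lemma finite_sides1 A : is_side A -> finite_sides A.
Proof.
move=> sA; exists 1%N, (fun=> A); split => //.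
by apply/seteqP; split => [z Az|z [] //]; exists 0%N.
Qed.

Lemma finite_sidesU A Z : finite_sides A -> finite_sides Z ->
  finite_sides (A `|` Z).
Proof.
move=> [n [F [sF ->]]] [m [G [sG ->]]].
exists (n + m)%N, (fun i => if (i < n)%N then F i else G (i - n)%N); split.
  move=> i hi; case: ltnP => [|ni]; first exact: sF.
  by apply: sG; rewrite ltn_subLR.
apply/seteqP; split => z.
  case=> -[i /= hi Fz].
    by exists i; [exact: ltn_addr|rewrite hi].
  by exists (n + i)%N; rewrite /= ?ltn_add2l // ltnNge leq_addr addKn.
case=> i /= hi; case: ltnP => ni Fz; [left|right]; first by exists i.
by exists (i - n)%N => //=; rewrite ltn_subLR.
Qed.

Lemma finite_sides_if (P : Prop) A : (P -> finite_sides A) ->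
  finite_sides [set z | P /\ A z].
Proof.
move=> h; have [HP|nP] := pselect P.
  by rewrite (_ : mkset _ = A); [exact: h|apply/seteqP; split => z // []].
rewrite (_ : mkset _ = set0); first exact: finite_sides0.
by apply/seteqP; split => z // [].
Qed.

Lemma finite_sides_bigcup (n : nat) (A : nat -> set plane) :
  (forall i, (i < n)%N -> finite_sides (A i)) ->
  finite_sides [set z | exists2 i, (i < n)%N & A i z].
Proof.
elim: n => [_|n IH h].
  rewrite (_ : mkset _ = set0); first exact: finite_sides0.
  by apply/seteqP; split => z // [].
rewrite (_ : mkset _ = [set z | exists2 i, (i < n)%N & A i z] `|` A n).
  by apply: finite_sidesU; [apply: IH => i /ltnW; exact: h|exact: h].
apply/seteqP; split => z.
  case=> i; rewrite ltnS leq_eqVlt => /orP[/eqP ->|ni] Az; first by right.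
  by left; exists i.
by case=> [[i ni Az]|Az]; [exists i => //; exact: ltnW|exists n].
Qed.

Lemma vert_line_side (a : R) (J : set R) : is_interval J ->
  (exists y1 y2, [/\ J y1, J y2 & y1 < y2]) -> is_side (vert_line a J).
Proof.
move=> iJ [y1 [y2 [J1 J2 y12]]]; split.
  exists J, (fun y => (a, y)); split => //; split; first by exists y1, y2.
  split.
    apply: continuous_subspaceT.
    by apply: continuous_pair'; [exact: cst_continuous|exact: continuous_id'].
  split; first by move=> x y _ _ [].
  apply/seteqP; split => [[x y] /= [/= -> Jy]|_ [y Jy <-]] //.
  by exists y.
(* For the constant polynomial [- a] and a right angle, [Phi] is [z.1 - a]. *)
exists (- a)%:P, (pi / 2) => z [za _].
by rewrite /rot_poly_graph /Phi /= cos_pihalf sin_pihalf hornerC za; lra.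
Qed.

End FiniteSides.

Lemma poly_isolated_root (R : realType) (q : {poly R}) (y0 : R) : q != 0 ->
  nbhs y0 [set y | y <> y0 -> q.[y] <> 0].
Proof.
move=> q0; have [m [r]] := multiplicity_XsubC q y0; rewrite q0 /= => r0 ->.
have nr : nbhs y0 [set y | r.[y] != 0].
  have -> : [set y | r.[y] != 0] = (horner r) @^-1` ~` [set 0].
    by apply/seteqP; split => y /=; [move=> /eqP|move=> h; apply/eqP].
  apply: open_nbhs_nbhs; split; last by move/eqP; apply/negP.
  apply: open_comp; first by move=> x _; exact: continuous_horner.
  apply: closed_openC; exact: accessible_closed_set1 (hausdorff_accessible _) _.
apply: filterS nr => y /= ry yy0; rewrite hornerM horner_exp !hornerE.
by apply/eqP; rewrite mulf_neq0 // expf_neq0 // subr_eq0; apply/eqP.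
Qed.

(** Hence on a vertical line [Phi] vanishes identically or has isolated zeros. *)
Lemma Phi_vertical_poly (R : realType) (p : {poly R}) (t a : R) :
  exists q : {poly R}, forall y, Phi p t (a, y) = q.[y].
Proof.
exists (p \Po ((a * cos t)%:P + sin t *: 'X) - ((- a * sin t)%:P + cos t *: 'X)).
by move=> y; rewrite /Phi /= !hornerE /= horner_comp !hornerE /= !(mulrC y).
Qed.

(** * Interior, closure and boundary of one component *)

Section Regions.
Variables (R : realType) (k : nat) (p : nat -> {poly R}) (t : nat -> R).
Local Notation plane := (R * R)%type.
Local Notation Ph i := (Phi (p i) (t i)).
Local Notation X := (\bigcap_(i in `I_k) poly_half_plane (p i) (t i)).
Variables (N : nat) (b : nat -> band R).
Hypothesis decb : decomposition k p t N b.
Variables T Z : set plane.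
Hypotheses (treeT : treelike T) (closedZ : closed Z) (TZ0 : T `&` Z = set0)
  (TZ : T `|` Z = bunion b N).

Let closedT : closed T. Proof. by case: treeT. Qed.

Let TZF z : T z -> Z z -> False.
Proof. by move=> Tz Zz; have : (T `&` Z) z by []; rewrite TZ0. Qed.

Let TW z : T z -> bunion b N z.
Proof. by move=> Tz; rewrite -TZ; left. Qed.

(** A point of [T] in [X] has a neighbourhood in [X] that misses the closed set [Z], and such a
    neighbourhood lies in [T]. *)
Lemma component_interior : interior T = T `&` X.
Proof.
apply/seteqP; split => z.
  move=> nT; split; first exact: nbhs_singleton nT.
  by apply: (nbhs_bunion_X decb); apply: filterS nT => w /TW.
move=> [Tz Xz]; have nX : nbhs z X by apply: open_nbhs_nbhs; split => //; exact: X_open.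
have nZ : nbhs z (~` Z).
  apply: open_nbhs_nbhs; split; first exact: closed_openC.
  by move=> Zz; exact: TZF Tz Zz.
apply: filterS (filterI nX nZ) => w [/(dec_cover decb)[n nN Bn] nZw].
have : (T `|` Z) w by rewrite TZ; exists n.
by case.
Qed.

Lemma component_band n z : (n < N)%N -> cband (b n) z -> T z -> cband (b n) `<=` T.
Proof.
move=> nN Bz Tz w Bw.
have BTZ : cband (b n) `<=` T `|` Z by move=> v Bv; rewrite TZ; exists n.
have [//|Zw] := BTZ _ Bw; exfalso.
have cB := treelike_connected (cband_treelike (dec_wf decb nN)).
have [||v [_ Tv Zv]] := connected_closed_cover cB closedT closedZ BTZ.
- by exists z.
- by exists w.
- exact: TZF Tv Zv.
Qed.

Lemma component_closure : closure (interior T) = T.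
Proof.
apply/seteqP; split => z.
  by move=> cz; apply: closedT; apply: closure_subset cz; exact: interior_subset.
move=> Tz; have [n nN Bn] := TW Tz.
have BT := component_band nN Bn Tz.
apply: closure_subset (cband_closure (dec_wf decb nN) Bn) => w Bw.
rewrite component_interior; split; first by apply: BT; exact: obandW.
exact: (dec_oband decb nN).
Qed.

Lemma component_boundary : boundary T = T `\` X.
Proof.
rewrite /boundary component_interior -(closure_id _).1 //.
apply/seteqP; split => z [Tz h]; split => //.
  by move=> Xz; apply: h.
by move=> [_ Xz]; exact: h.
Qed.

Definition lower_side (B : band R) : set plane :=
  [set z | cstrip B z.1 /\ exists2 f, bf B = Some f & z.2 = f z.1].
Definition upper_side (B : band R) : set plane :=
  [set z | cstrip B z.1 /\ exists2 f, bg B = Some f & z.2 = f z.1].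
Definition left_side (B : band R) : set plane :=
  [set z | ba B = Some z.1 /\ cband B z].
Definition right_side (B : band R) : set plane :=
  [set z | bb B = Some z.1 /\ cband B z].
(** Applied to the vertical ends of bands: it singles out those that are genuine boundary arcs from
    those that merely come from a cut. *)
Definition is_edge (E : set plane) :=
  E `<=` ~` X /\ exists u v, [/\ E u, E v & u.2 < v.2].

Definition band_boundary (B : band R) : set plane :=
  [set z | cband B `<=` T /\ (lower_side B `|` upper_side B `|`
    ([set z | is_edge (left_side B) /\ left_side B z] `|`
     [set z | is_edge (right_side B) /\ right_side B z])) z].

Lemma graph_is_side B (f : R -> R) : bandwf B -> continuous f -> on_graph k p t B f ->
  is_side [set z | cstrip B z.1 /\ z.2 = f z.1].
Proof.
move=> [[x0 /andP[ax xb]] _ _ _] cf [i ik hi]; split; last first.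
  exists (p i), (t i) => z [cz zf]; rewrite /rot_poly_graph /=.
  by rewrite [z]surjective_pairing zf hi.
exists [set x | cstrip B x], (fun x => (x, f x)); split.
  move=> x y /andP[h1 h2] /andP[h3 h4] w hw; apply/andP; split.
    by case: (ba B) h1 => //= a; lra.
  by case: (bb B) h4 => //= a; lra.
split.
  exists x0, (if bb B is Some c then (x0 + c) / 2 else x0 + 1).
  rewrite /cstrip; case: (ba B) (bb B) ax xb => [a|] [c|] /= ax xb;
    by split; [|split]; rewrite /= ?andbT //; lra.
split.
  by apply: continuous_subspaceT; apply: continuous_pair' => //; exact: continuous_id'.
split; first by move=> x y _ _ [].
apply/seteqP; split => [[x y] /= [cx ->]|_ [x cx <-]] //.
by exists x.
Qed.

Lemma end_is_side B (a : R) : is_edge [set z | a = z.1 /\ cband B z] ->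
  is_side [set z | a = z.1 /\ cband B z].
Proof.
move=> [_ [u [v [[ua Bu] [va Bv] uv]]]].
have -> : [set z | a = z.1 /\ cband B z] = vert_line a [set y | cband B (a, y)].
  apply/seteqP; split => z; first by case=> -> Bz; split; rewrite //= -surjective_pairing.
  by case=> <-; rewrite /= -surjective_pairing.
apply: vert_line_side; last first.
  by exists u.2, v.2; split; rewrite //= ?ua ?va -?surjective_pairing // -ua va
    -surjective_pairing.
move=> y1 y2 /and3P[h1 h2 h3] /and3P[_ h4 h5] y hy; apply/and3P; split => //=.
  by move: h2 => /=; case: (bf B) => [f|] //=; lra.
by move: h5 => /=; case: (bg B) => [f|] //=; lra.
Qed.

Lemma band_boundary_sides n : (n < N)%N -> finite_sides (band_boundary (b n)).
Proof.
move=> nN; apply: finite_sides_if => _; have wf := dec_wf decb nN.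
have [_ cf cg _] := wf.
apply: finite_sidesU; apply: finite_sidesU.
- case E : (bf (b n)) cf => [f|] cf; last first.
    rewrite (_ : lower_side _ = set0); first exact: finite_sides0.
    by apply/seteqP; split => z // [_ []]; rewrite E.
  rewrite (_ : lower_side _ = [set z | cstrip (b n) z.1 /\ z.2 = f z.1]).
    by apply/finite_sides1/graph_is_side => //; exact: (dec_bf decb).
  apply/seteqP; split => z [cz]; first by rewrite E => -[_ [<-]].
  by move=> zf; split => //; exists f.
- case E : (bg (b n)) cg => [f|] cg; last first.
    rewrite (_ : upper_side _ = set0); first exact: finite_sides0.
    by apply/seteqP; split => z // [_ []]; rewrite E.
  rewrite (_ : upper_side _ = [set z | cstrip (b n) z.1 /\ z.2 = f z.1]).
    by apply/finite_sides1/graph_is_side => //; exact: (dec_bg decb).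
  apply/seteqP; split => z [cz]; first by rewrite E => -[_ [<-]].
  by move=> zf; split => //; exists f.
- apply: finite_sides_if; rewrite /left_side; case: (ba (b n)) => [a|]; last first.
    by case=> _ [u [v [[]]]].
  rewrite (_ : mkset _ = [set z | a = z.1 /\ cband (b n) z]).
    by move=> h; apply/finite_sides1/end_is_side.
  by apply/seteqP; split => z [[->]].
- apply: finite_sides_if; rewrite /right_side; case: (bb (b n)) => [a|]; last first.
    by case=> _ [u [v [[]]]].
  rewrite (_ : mkset _ = [set z | a = z.1 /\ cband (b n) z]).
    by move=> h; apply/finite_sides1/end_is_side.
  by apply/seteqP; split => z [[->]].
Qed.

(** A [Phi] vanishing on the whole vertical line keeps this end of the band out of [X], and a point
    strictly between the graphs makes the end longer than a point. *)
Lemma is_edge_dense n z (E : set plane) : (n < N)%N -> cband (b n) z ->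
  gto (appo (bf (b n)) z.1) z.2 -> lto (appo (bg (b n)) z.1) z.2 ->
  (forall w, E w <-> z.1 = w.1 /\ cband (b n) w) ->
  (exists2 i, (i < k)%N & forall y, Ph i (z.1, y) = 0) -> is_edge E.
Proof.
move=> nN Bz fz gz hE [i ik hi]; split.
  move=> w /hE[zw _] Xw; have := Xw i ik; rewrite /= /poly_half_plane /=.
  by rewrite [w]surjective_pairing -zw hi ltxx.
exists z, (z.1, if bg (b n) is Some g then (z.2 + g z.1) / 2 else z.2 + 1).
case/and3P: Bz => cz _ _; split; [apply/hE; split=> //|apply/hE; split=> //|].
- by apply/and3P; split; rewrite ?gtoW ?ltoW.
- apply/and3P; split => //=.
    case: (bf (b n)) fz => //= f fz; case: (bg (b n)) gz => [g|] /=; lra.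
  by case: (bg (b n)) gz => [g|] //=; lra.
- by move: gz => /=; case: (bg (b n)) => [g|] /=; lra.
Qed.

(** The part of the segment in [T] is closed because [T] is, and open in the segment because it lies
    in [X], hence in the interior of [T]. *)
Lemma segment_in_component (u v : plane) :
  (forall s, 0 <= s <= 1 -> let w := (u.1 + s * (v.1 - u.1), u.2 + s * (v.2 - u.2)) in
     T w -> X w) -> T u -> T v.
Proof.
move=> hX Tu; pose e (s : R) := (u.1 + s * (v.1 - u.1), u.2 + s * (v.2 - u.2)).
have ce : continuous e by apply: continuous_pair'; exact: continuous_affine.
have cA : connected (e @` unit_itv (R := R)).
  apply: connected_continuous_connected; last exact: continuous_subspaceT.
  apply/connected_intervalP => x y hx hy w; move: hx hy; rewrite /unit_itv /=; lra.
have AT : e @` unit_itv (R := R) `&` T = e @` unit_itv (R := R).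
  apply: cA; last by exists T.
    exists u; split => //; exists 0; first exact: unit_itv0.
    by rewrite /e !mul0r !addr0 -surjective_pairing.
  exists (interior T); first exact: open_interior.
  apply/seteqP; split => w [Aw Tw]; split => //; last exact: interior_subset.
  rewrite component_interior; split => //; move: Aw Tw => [s us <-] Tw.
  exact: hX.
have : (e @` unit_itv (R := R)) v.
  exists 1; first exact: unit_itv1.
  by rewrite /e !mul1r !(addrC _ (_ - _)) !subrK -surjective_pairing.
by rewrite -AT => -[].
Qed.

(* A punctured box around [z] then lies in [T], so that [z] is interior to the
   closure of [X], where every [Phi] is positive. *)
Lemma not_isolated_boundary n z : (n < N)%N -> T z -> cband (b n) z ->
  gto (appo (bf (b n)) z.1) z.2 -> lto (appo (bg (b n)) z.1) z.2 ->
  nbhs z [set w | T w -> w <> z -> X w] -> X z.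
Proof.
move=> nN Tz Bz fz gz /nbhs_ballP[e /= e0 he].
have wfn := dec_wf decb nN; have [_ cf cg _] := wfn.
have box w : `|z.1 - w.1| < e -> `|z.2 - w.2| < e -> T w -> w <> z -> X w.
  by move=> h1 h2; apply: he; split.
have [d d0 hd] : exists2 d, 0 < d & forall s, 0 <= s <= d ->
    T (z.1, z.2 + s) /\ T (z.1, z.2 - s).
  have c1 : continuous (fun y : R => z.1) by exact: continuous_cst'.
  have n1 : nbhs z.2 [set y | gto (appo (bf (b n)) z.1) y].
    apply: open_nbhs_nbhs; split => //.
    by apply: (@open_gto _ _ (bf (b n)) (fun=> z.1) id) => //; exact: continuous_id'.
  have n2 : nbhs z.2 [set y | lto (appo (bg (b n)) z.1) y].
    apply: open_nbhs_nbhs; split => //.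
    by apply: (@open_lto _ _ (bg (b n)) (fun=> z.1) id) => //; exact: continuous_id'.
  have [d d0 hd] := nbhs_right_exists (filterI n1 n2).
  have BT y : gto (appo (bf (b n)) z.1) y -> lto (appo (bg (b n)) z.1) y -> T (z.1, y).
    move=> h1 h2; apply: (component_band nN Bz Tz).
    by case/andP: Bz => cz _; apply/and3P; split; rewrite ?gtoW ?ltoW.
  by exists d => // s /hd[[h1 h2] [h3 h4]]; split; exact: BT.
pose r := Num.min d (e / 2).
have r0 : 0 < r by rewrite lt_min d0 divr_gt0.
have rd : r <= d by rewrite ge_min lexx.
have re : r < e by rewrite gt_min; apply/orP; right; lra.
have [Tu Tl] : T (z.1, z.2 + r) /\ T (z.1, z.2 - r) by apply: hd; rewrite ltW.
have go u v : `|z.1 - u.1| < e -> `|z.2 - u.2| < e ->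
    `|z.1 - v.1| < e -> `|z.2 - v.2| < e ->
    (forall s, 0 <= s <= 1 ->
      (u.1 + s * (v.1 - u.1), u.2 + s * (v.2 - u.2)) <> z) -> T u -> T v.
  have dE (x y : R) : (`|x - y| < e) = (x - e < y < x + e).
    by rewrite distrC ltr_distl.
  rewrite !dE => u1 u2 v1 v2 nz.
  apply: segment_in_component => s hs w Tw.
  apply: box => //; last exact: nz.
    by rewrite dE; apply/andP; split; [apply: convex_gt|apply: convex_lt]; lra.
  by rewrite dE; apply/andP; split; [apply: convex_gt|apply: convex_lt]; lra.
(* The points at distance [r] above and below [z] are in [T]. A segment from one of them to a point
   on the same side of the horizontal line through [z] avoids [z]. *)
have up w : `|z.1 - w.1| < e -> `|z.2 - w.2| < e -> z.2 < w.2 -> T w.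
  move=> h1 h2 zw; apply: (go (z.1, z.2 + r)) => //=.
  - by rewrite subrr normr0.
  - by rewrite opprD addrA subrr sub0r normrN gtr0_norm.
  - move=> s hs /(congr1 snd) /= E.
    by have := @convex_gt R z.2 (z.2 + r) w.2 s hs; rewrite E ltxx ltrDl => /(_ r0 zw).
have down w : `|z.1 - w.1| < e -> `|z.2 - w.2| < e -> w.2 < z.2 -> T w.
  move=> h1 h2 zw; apply: (go (z.1, z.2 - r)) => //=.
  - by rewrite subrr normr0.
  - by rewrite opprB addrC subrK gtr0_norm.
  - move=> s hs /(congr1 snd) /= E.
    have := @convex_lt R z.2 (z.2 - r) w.2 s hs; rewrite E ltxx.
    by rewrite gtrBl => /(_ r0 zw).
apply: (nbhs_bunion_X decb); apply/nbhs_ballP; exists e => // w [h1 h2].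
apply: TW; rewrite /ball /= in h1 h2.
have [zw|zw|zw] := ltgtP z.2 w.2; [exact: up|exact: down|].
have [E1|E1] := eqVneq z.1 w.1.
  by rewrite [w]surjective_pairing -E1 -zw -surjective_pairing.
have h3 : `|z.2 - (z.2 + r)| < e.
  by rewrite opprD addrA subrr sub0r normrN gtr0_norm.
(* A point at the height of [z] is reached vertically, the abscissa staying different from [z.1]. *)
apply: (go (w.1, z.2 + r)) => //=.
- move=> s _ /(congr1 fst) /=; rewrite subrr mulr0 addr0 => E.
  by rewrite E eqxx in E1.
- by apply: up => //=; rewrite ltrDl.
Qed.

(** A point of [T] outside [X] and on no listed side lies strictly between the graphs of every band
    through it, and over an end of its strip. No [Phi] vanishes on the whole vertical line, as this
    would make that end an edge; so zeros on the line are isolated, and near the point all other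
    points of [T] are in [X]. This contradicts [not_isolated_boundary]. *)
Lemma component_sides : finite_sides (T `\` X).
Proof.
rewrite (_ : T `\` X = [set z | exists2 n, (n < N)%N & band_boundary (b n) z]).
  by apply: finite_sides_bigcup; exact: band_boundary_sides.
have wf n : (n < N)%N -> bandwf (b n) by exact: (dec_wf decb).
apply/seteqP; split => z; last first.
  have nX n f : on_graph k p t (b n) f -> cstrip (b n) z.1 -> z.2 = f z.1 -> ~ X z.
    move=> [i ik hi] cz zf Xz; have := Xz i ik.
    by rewrite /poly_half_plane /= [z]surjective_pairing zf hi // ltxx.
  case=> n nN [BT [[]|[]]] => [[cz [f Ef zf]]|[cz [f Ef zf]]|[[h _] E]|[[h _] E]].
  - split; last by apply: (nX n f) => //; exact: (dec_bf decb).
    apply: BT; have := band_ole (wf _ nN) cz; rewrite /cband /= cz Ef /= zf lexx.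
    by case: (bg (b n)).
  - split; last by apply: (nX n f) => //; exact: (dec_bg decb).
    apply: BT; have := band_ole (wf _ nN) cz; rewrite /cband /= cz Ef /= zf lexx.
    by rewrite andbT; case: (bf (b n)).
  - by split; [apply: BT; case: E|exact: h].
  - by split; [apply: BT; case: E|exact: h].
move=> [Tz nXz]; apply: contrapT => nU.
have strict m : (m < N)%N -> cband (b m) z -> gto (appo (bf (b m)) z.1) z.2 &&
    lto (appo (bg (b m)) z.1) z.2.
  move=> mN Bm; have BT := component_band mN Bm Tz; case/and3P: (Bm) => cz fz gz.
  apply/andP; split.
    case E : (bf (b m)) fz => [f|] //= fz; rewrite lt_neqAle fz andbT.
    apply/eqP => zf; apply: nU; exists m => //; split => //; left; left; split => //.
    by exists f.
  case E : (bg (b m)) gz => [f|] //= gz; rewrite lt_neqAle gz andbT.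
  apply/eqP => zf; apply: nU; exists m => //; split => //; left; right; split => //.
  by exists f.
have notin m : (m < N)%N -> cband (b m) z -> ~~ ostrip (b m) z.1.
  move=> mN Bm; apply/negP => oz; apply: nXz; apply: (dec_oband decb mN).
  by rewrite /oband /= oz strict.
have [n nN Bn] := TW Tz; have BT := component_band nN Bn Tz.
have /andP[fz gz] := strict _ nN Bn.
apply: nXz; apply: (not_isolated_boundary nN Tz Bn fz gz).
have nvert i : (i < k)%N -> exists y, Ph i (z.1, y) <> 0.
  move=> ik; apply/existsNP => hi; apply: nU; exists n => //; split => //; right.
  have hex : exists2 i, (i < k)%N & forall y, Ph i (z.1, y) = 0 by exists i.
  have := notin _ nN Bn; rewrite /ostrip negb_and.
  case/andP: (Bn) => /andP[az bz] _ /orP[na|nb]; [left|right].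
    have Ea : ba (b n) = Some z.1.
      case: (ba (b n)) na az => //= a na az.
      by congr Some; apply/eqP; rewrite eq_le az leNgt na.
    split; last by split.
    apply: (is_edge_dense nN Bn fz gz) hex => w; rewrite /left_side /= Ea.
    by split=> -[]; [case=> -> ?|move=> -> ?].
  have Eb : bb (b n) = Some z.1.
    case: (bb (b n)) nb bz => //= a na bz.
    by congr Some; apply/eqP; rewrite eq_le bz leNgt na.
  split; last by split.
  apply: (is_edge_dense nN Bn fz gz) hex => w; rewrite /right_side /= Eb.
  by split=> -[]; [case=> -> ?|move=> -> ?].
have c1 : continuous (fun z : plane => z.1) by exact/continuous_fst'/continuous_id'.
have c2 : continuous (fun z : plane => z.2) by exact/continuous_snd'/continuous_id'.
have n1 : nbhs z [set w | forall i, (i < k)%N -> w.1 = z.1 -> w <> z -> Ph i w <> 0].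
  apply: (@filter_forall_lt _ _ k
    (fun i => [set w | w.1 = z.1 -> w <> z -> Ph i w <> 0])) => i ik.
  have [q hq] := Phi_vertical_poly (p i) (t i) z.1.
  have q0 : q != 0.
    by apply/eqP => q0; have [y] := nvert _ ik; rewrite hq q0 horner0.
  have nq : nbhs z (snd @^-1` [set y | y <> z.2 -> q.[y] <> 0]).
    exact: (c2 z _ (poly_isolated_root z.2 q0)).
  apply: filterS nq => w /= hw w1 wz.
  rewrite [w]surjective_pairing w1 hq; apply: hw => w2; apply: wz.
  by rewrite [w]surjective_pairing w1 w2 -surjective_pairing.
have other (o : option R) : nbhs z [set w | o = Some w.1 -> w.1 = z.1].
  case: o => [c|]; last by apply: filterE.
  have [->|cz] := eqVneq c z.1; first by apply: filterE => w [].
  have : nbhs z [set w : plane | w.1 != c].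
    have -> : [set w : plane | w.1 != c] = fst @^-1` ~` [set c].
      by apply/seteqP; split => w /=; [move=> /eqP|move=> h; apply/eqP].
    apply: open_nbhs_nbhs; split; last by move/eqP; rewrite eq_sym (negbTE cz).
    apply: open_comp; first by move=> w _; exact: c1.
    apply: closed_openC; exact: accessible_closed_set1 (hausdorff_accessible _) _.
  by apply: filterS => w /= /eqP wc [] /esym.
(* Off the vertical line, points near [z] in a band through [z] belong to the open band; a band not
   through [z] is closed and stays away. *)
have n2 : nbhs z [set w | forall m, (m < N)%N -> cband (b m) w -> w.1 <> z.1 -> X w].
  apply: (@filter_forall_lt _ _ N
    (fun m => [set w | cband (b m) w -> w.1 <> z.1 -> X w])) => m mN.
  have [Bm|nBm] := pselect (cband (b m) z); last first.
    have nB : nbhs z (~` cband (b m)).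
      by apply: open_nbhs_nbhs; split => //; exact/closed_openC/cband_closed/wf.
    by apply: filterS nB => w nBw /nBw.
  have /andP[fm gm] := strict _ mN Bm; have [_ cf cg _] := wf _ mN.
  have m1 : nbhs z [set w | gto (appo (bf (b m)) w.1) w.2].
    by apply: open_nbhs_nbhs; split => //; exact: open_gto.
  have m2 : nbhs z [set w | lto (appo (bg (b m)) w.1) w.2].
    by apply: open_nbhs_nbhs; split => //; exact: open_lto.
  apply: filterS (filterI (filterI m1 m2)
    (filterI (other (ba (b m))) (other (bb (b m))))).
  move=> w [[w1 w2] [w3 w4]] /andP[/andP[aw bw] _] wz.
  apply: (dec_oband decb mN); rewrite /oband /ostrip /= w1 w2 !andbT.
  apply/andP; split.
    move: w3 aw; case: (ba (b m)) => //= a w3 aw; rewrite lt_neqAle aw andbT.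
    by apply/eqP => E; apply/wz/w3; rewrite E.
  move: w4 bw; case: (bb (b m)) => //= a w4 bw; rewrite lt_neqAle bw andbT.
  by apply/eqP => E; apply/wz/w4; rewrite E.
apply: filterS (filterI n1 n2) => w [h1 h2] Tw wz.
have [m mN Bm] := TW Tw.
have [w1|w1] := eqVneq w.1 z.1; last by apply: (h2 m) => //; apply/eqP.
move=> i ik; rewrite /= /poly_half_plane /= lt_neqAle eq_sym.
rewrite (cband_Phi_ge0 decb mN ik Bm) andbT; apply/eqP; exact: h1.
Qed.

Lemma component_region : region_typeI T.
Proof.
split => //; split; first exact: treelike_connected.
split.
  by split; [exact: treelike_path_connected|exact: treelike_loops_contractible].
split; first exact: component_closure.
by rewrite component_boundary; exact: component_sides.
Qed.

End Regions.

Lemma decomposition_regions (R : realType) (k : nat) (p : nat -> {poly R})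
    (t : nat -> R) (N : nat) (b : nat -> band R) : decomposition k p t N b ->
  exists (n : nat) (F : nat -> set (R * R)),
    (forall i, (i < n)%N -> region_typeII (F i)) /\
    (forall i j, (i < n)%N -> (j < n)%N -> i <> j -> F i `&` F j = set0) /\
    \bigcap_(i in `I_k) poly_half_plane (p i) (t i) = \bigcup_(i in `I_n) F i.
Proof.
move=> decb; have [n [C [hC dC defW]]] := forest_components (bunion_forest decb).
have intC i : (i < n)%N -> interior (C i) =
    C i `&` \bigcap_(i in `I_k) poly_half_plane (p i) (t i).
  by move=> /hC[tC [Z cZ [d e]]]; exact: (component_interior decb cZ d e).
exists n, (fun i => interior (C i)); split.
  move=> i /hC[tC [Z cZ [d e]]]; exists (C i); split => //.
  exact: (component_region decb tC cZ d e).
split.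
  move=> i j hi hj ij; rewrite -subset0 -(dC i j) // => z [h1 h2].
  by split; exact: interior_subset.
apply/seteqP; split => z.
  move=> Xz; have [m mN Bm] := dec_cover decb Xz.
  have : bunion b N z by exists m.
  by rewrite defW => -[i hi Ci]; exists i => //; rewrite intC.
by case=> i hi; rewrite intC // => -[].
Qed.

(** * Existence of a decomposition *)

Section Gaps.
Variable R : realType.
Implicit Types (s : seq R) (lo : option R) (g : option R * option R).

(** Serves for the strips, for the cells within a strip, and for the intervals of monotonicity of a
    polynomial. *)
Fixpoint gaps lo s : seq (option R * option R) :=
  if s is a :: s' then (lo, Some a) :: gaps (Some a) s' else [:: (lo, None)].

Definition opath lo s := if lo is Some l then path <%R l s else sorted <%R s.

Definition gap_le g g' :=
  match g.2, g'.1 with Some r, Some r' => r <= r' | _, _ => false end.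

Lemma opath_cons lo a s : opath lo (a :: s) -> opath (Some a) s.
Proof. by case: lo => [l|] //= /andP[]. Qed.

Lemma gaps_bounds lo s g : opath lo s -> g \in gaps lo s ->
  [/\ olt g.1 g.2, g.1 = lo \/ (exists2 a, a \in s & g.1 = Some a),
      (forall a, g.2 = Some a -> a \in s) &
      (forall a, a \in s -> gto g.1 a -> lto g.2 a -> False)].
Proof.
elim: s lo => [|a s IH] lo /=.
  by move=> _; rewrite inE => /eqP ->; split => //; [case: (lo)|left].
move=> los; rewrite inE => /orP[/eqP ->|gs].
  split; [|by left|by move=> c [<-]; rewrite mem_head|].
    by case: lo los => [l|] //= /andP[].
  move=> c; rewrite inE /= => /orP[/eqP -> _|cs _]; first by rewrite ltxx.
  have := opath_cons los; rewrite /= path_sortedE; last exact: lt_trans.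
  by case/andP => /allP/(_ _ cs) ac _ /(lt_trans ac); rewrite ltxx.
have las := opath_cons los.
have [h1 h2 h3 h4] := IH _ las gs; split => //.
- right; case: h2 => [->|[c cs ->]]; first by exists a; rewrite ?mem_head.
  by exists c; rewrite ?inE ?cs ?orbT.
- by move=> c /h3 cs; rewrite inE cs orbT.
- move=> c; rewrite inE => /orP[/eqP ->|]; last exact: h4.
  case: h2 => [->|[d ds ->]] /=; first by rewrite ltxx.
  move: las; rewrite /= path_sortedE; last exact: lt_trans.
  by case/andP => /allP/(_ _ ds) ad _ /(lt_trans ad); rewrite ltxx.
Qed.

(** A downward closed predicate replaces the point sought, so that the search also works for arcs
    compared with a point over its own abscissa. *)
Lemma gaps_locate lo s (A : pred R) : opath lo s ->
  (forall a a', a \in s -> a' \in s -> a < a' -> A a' -> A a) ->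
  exists g, [/\ g \in gaps lo s, g.1 = lo \/ (exists2 a, g.1 = Some a & A a) &
                forall a, g.2 = Some a -> ~~ A a].
Proof.
elim: s lo => [|a s IH] lo /= los mA.
  by exists (lo, None); rewrite inE eqxx; split => //; left.
have las := opath_cons los.
have [Aa|nAa] := boolP (A a); last first.
  by exists (lo, Some a); rewrite mem_head; split => //; [left|move=> c [<-]].
have [|g [gs h1 h2]] := IH _ las.
  by move=> c c' cs cs'; apply: mA; rewrite inE ?cs ?cs' orbT.
exists g; rewrite inE gs orbT; split => //; right.
by case: h1 => [->|//]; exists a.
Qed.

Lemma gaps_pairwise lo s : opath lo s -> pairwise gap_le (gaps lo s).
Proof.
elim: s lo => [|a s IH] lo //= los; have las := opath_cons los.
rewrite IH // andbT; apply/allP => g /(gaps_bounds las)[_ h _ _].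
rewrite /gap_le /=; case: h => [->|[c cs ->]] //.
move: las; rewrite /= path_sortedE; last exact: lt_trans.
by case/andP => /allP/(_ _ cs)/ltW.
Qed.

Lemma finite_sorted_seq (A : set R) : finite_set A ->
  exists2 s, sorted <%R s & forall x, (x \in s) <-> A x.
Proof.
move=> /finite_seqP[s ->]; exists (sort <=%R (undup s)).
  by rewrite sort_lt_sorted undup_uniq.
by move=> x; rewrite mem_sort mem_undup.
Qed.

End Gaps.

Lemma poly_roots_finite (R : realType) (q : {poly R}) :
  finite_set [set x | q != 0 /\ root q x].
Proof.
have [n] := ubnP (size q); elim: n q => // n IH q sq.
have [[a [q0 ra]]|nr] := pselect (exists a, q != 0 /\ root q a); last first.
  rewrite (_ : mkset _ = set0) //; apply/seteqP; split => x //= h.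
  by apply: nr; exists x.
have /factor_theorem[r Er] := ra.
have r0 : r != 0 by apply: contraNneq q0 => r0; rewrite Er r0 mul0r.
have sr : (size r < n)%N.
  move: sq; rewrite Er size_Mmonic ?monicXsubC // size_XsubC addn2 /=.
  by rewrite ltnS.
apply: (@sub_finite_set _ _ ([set a] `|` [set x | r != 0 /\ root r x])).
  move=> x [_]; rewrite Er rootM root_XsubC => /orP[rx|/eqP ->]; first by right.
  by left.
by rewrite finite_setU; split; [exact: finite_set1|exact: IH].
Qed.

Lemma poly_unbounded_right (R : realType) (q : {poly R}) (x M : R) :
  (1 < size q)%N -> exists2 s, x <= s & M < `|q.[s]|.
Proof.
wlog lq : q / 0 < lead_coef q => [hw sq|sq].
  have [/hw|l0] := ltP 0 (lead_coef q); first exact.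
  have [||s xs] := hw (- q); last by rewrite hornerN normrN; exists s.
    rewrite lead_coefN oppr_gt0 lt_neqAle l0 andbT lead_coef_eq0 -size_poly_gt0.
    exact: leq_trans sq.
  by rewrite size_polyN.
have [n hn] := polyrcf.poly_lim_infty (M + 1) lq sq.
exists (Num.max x n); first by rewrite le_max lexx.
apply: lt_le_trans (ler_norm _); apply: lt_le_trans (hn _ _); first by lra.
by rewrite le_max lexx orbT.
Qed.

Lemma poly_unbounded_left (R : realType) (q : {poly R}) (x M : R) :
  (1 < size q)%N -> exists2 s, s <= x & M < `|q.[s]|.
Proof.
move=> sq; have [|s xs] := @poly_unbounded_right _ (q \Po - 'X) (- x) M.
  by rewrite size_comp_poly2 // size_polyN size_polyX.
by rewrite horner_comp !hornerE => h; exists (- s) => //; lra.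
Qed.

Definition in_gap (R : realType) (g : option R * option R) (x : R) :=
  geo g.1 x && leo g.2 x.
Definition inside_gap (R : realType) (g : option R * option R) (x : R) :=
  gto g.1 x && lto g.2 x.

Lemma inside_gapW (R : realType) (g : option R * option R) x :
  inside_gap g x -> in_gap g x.
Proof. by case/andP => ? ?; rewrite /in_gap gtoW ?ltoW. Qed.

Lemma inside_gap_mid (R : realType) (g : option R * option R) :
  olt g.1 g.2 -> inside_gap g (mido g.1 g.2).
Proof. by move=> lt; rewrite /inside_gap gto_mido ?lto_mido. Qed.

Lemma in_gap_itv (R : realType) (g : option R * option R) x y z :
  in_gap g x -> in_gap g y -> x <= z <= y -> in_gap g z.
Proof.
move=> /andP[h1 _] /andP[_ h2] /andP[xz zy]; apply/andP; split.
  by case: g.1 h1 => //= a h; exact: le_trans xz.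
by case: g.2 h2 => //= a h; exact: le_trans h.
Qed.

Lemma inside_gap_itv (R : realType) (g : option R * option R) x y z :
  inside_gap g x -> inside_gap g y -> x <= z <= y -> inside_gap g z.
Proof.
move=> /andP[h1 _] /andP[_ h2] /andP[xz zy]; apply/andP; split.
  by case: g.1 h1 => //= a h; exact: lt_le_trans xz.
by case: g.2 h2 => //= a h; exact: le_lt_trans h.
Qed.

Lemma IVT_sign_gap (R : realType) (h : R -> R) g (x y : R) : continuous h ->
  inside_gap g x -> inside_gap g y -> (forall s, inside_gap g s -> h s != 0) ->
  (h x < 0) = (h y < 0).
Proof.
move=> ch gx gy hg; have [xy|/ltW yx] := leP x y.
  by apply: IVT_sign => // s hs; apply: hg; exact: inside_gap_itv hs.
by symmetry; apply: IVT_sign => // s hs; apply: hg; exact: inside_gap_itv hs.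
Qed.

Section Branches.
Variable R : realType.
Implicit Types (q : {poly R}) (g : option R * option R).

(** [s] is the preimage of [x], or the end of the gap nearest to it when [x] is out of range. At an
    infinite end this cannot happen, as [q] is unbounded there. *)
Lemma increasing_value q g x : (1 < size q)%N -> olt g.1 g.2 ->
  (forall x y, in_gap g x -> in_gap g y -> x < y -> q.[x] < q.[y]) ->
  exists s, in_gap g s /\ [\/ q.[s] = x, x < q.[s] /\ g.1 = Some s |
                              q.[s] < x /\ g.2 = Some s].
Proof.
move=> sq ltg inc; set m := mido g.1 g.2.
have gm : in_gap g m by exact/inside_gapW/inside_gap_mid.
have [g1m g2m] := andP gm.
have incW y y' : in_gap g y -> in_gap g y' -> y <= y' -> q.[y] <= q.[y'].
  by move=> gy gy'; rewrite le_eqVlt => /orP[/eqP ->//|/inc h]; exact/ltW/h.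
pose M := Num.max `|x| `|q.[m]|.
have Mx : `|x| <= M by rewrite le_max lexx.
have Mm : `|q.[m]| <= M by rewrite le_max lexx orbT.
have [s1|[s1 gs1 qs1]] : (exists s, in_gap g s /\ [\/ q.[s] = x, x < q.[s] /\ g.1 = Some s |
      q.[s] < x /\ g.2 = Some s]) \/ exists2 s, in_gap g s & q.[s] <= x.
- case E : g.1 => [d|].
    have gd : in_gap g d.
      rewrite /in_gap E /= lexx /=; move: g2m g1m; rewrite E /=.
      by case: g.2 => //= c h1 h2; exact: le_trans h2 h1.
    have [qd|qd] := leP q.[d] x; first by right; exists d.
    by left; exists d; split => //; apply: Or32.
  have [s sm Ms] := poly_unbounded_left m M sq.
  have gs : in_gap g s.
    by rewrite /in_gap E /=; case: g.2 g2m => //= c; exact: le_trans.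
  right; exists s => //; have := incW _ _ gs gm sm.
  have := ler_norm q.[m]; have := ler_norm (- x); rewrite normrN.
  by move: Ms; case: (ger0P q.[s]); lra.
- exact: s1.
have [s2|[s2 gs2 qs2]] : (exists s, in_gap g s /\ [\/ q.[s] = x, x < q.[s] /\ g.1 = Some s |
      q.[s] < x /\ g.2 = Some s]) \/ exists2 s, in_gap g s & x <= q.[s].
- case E : g.2 => [d|].
    have gd : in_gap g d.
      rewrite /in_gap E /= lexx andbT; move: g2m g1m; rewrite E /=.
      by case: g.1 => //= c h1 h2; exact: le_trans h2 h1.
    have [qd|qd] := leP x q.[d]; first by right; exists d.
    by left; exists d; split => //; apply: Or33.
  have [s sm Ms] := poly_unbounded_right m M sq.
  have gs : in_gap g s.
    by rewrite /in_gap E /= andbT; case: g.1 g1m => //= c h; exact: le_trans sm.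
  right; exists s => //; have := incW _ _ gm gs sm.
  have := ler_norm (- q.[m]); have := ler_norm x; rewrite normrN.
  by move: Ms; case: (ger0P q.[s]); lra.
- exact: s2.
have s12 : s1 <= s2.
  rewrite leNgt; apply/negP => /(inc _ _ gs2 gs1) h.
  by have := lt_le_trans h (le_trans qs1 qs2); rewrite ltxx.
have [|s] := IVT s12 (continuous_subspaceT (@continuous_horner R q)) (v := x).
  by rewrite ge_min le_max qs1 qs2 orbT.
rewrite in_itv /= => hs qs; exists s; split; last exact: Or31.
exact: in_gap_itv hs.
Qed.

(** The inverse is extended by constants. Monotonicity gives continuity: [f x] stays below
    [f x0 + e] as long as [x] is below [q.[f x0 + e]], or for all [x] if [f x0 + e] is outside the
    gap; likewise from below. *)
Lemma increasing_branch q g : (1 < size q)%N -> olt g.1 g.2 ->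
  (forall x y, in_gap g x -> in_gap g y -> x < y -> q.[x] < q.[y]) ->
  exists f : R -> R, [/\ continuous f, forall x, in_gap g (f x) &
    forall x, [\/ q.[f x] = x, x < q.[f x] /\ g.1 = Some (f x) |
                  q.[f x] < x /\ g.2 = Some (f x)]].
Proof.
move=> sq ltg inc.
have /choice[f hf] := fun x => increasing_value x sq ltg inc.
exists f; split; [|by move=> x; have [] := hf x|by move=> x; have [] := hf x].
have incW y y' : in_gap g y -> in_gap g y' -> y <= y' -> q.[y] <= q.[y'].
  by move=> gy gy'; rewrite le_eqVlt => /orP[/eqP ->//|/inc h]; exact/ltW/h.
have g1P y s : g.1 = Some y -> in_gap g s -> y <= s by rewrite /in_gap => -> /andP[].
have g2P y s : g.2 = Some y -> in_gap g s -> s <= y by rewrite /in_gap => -> /andP[].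
move=> x0; apply/cvgrPdist_lt => e e0; have [gf0 hf0] := hf x0.
have [d1 d10 hd1] : exists2 d, 0 < d & forall x, x < x0 + d -> f x < f x0 + e.
  have [ge|nge] := boolP (in_gap g (f x0 + e)); last first.
    exists 1 => // x _; rewrite ltNge; apply: contra nge => h.
    have [gfx _] := hf x; apply: (in_gap_itv gf0 gfx); rewrite h andbT; lra.
  have q0 : x0 < q.[f x0 + e].
    have h : q.[f x0] < q.[f x0 + e] by apply: inc => //; lra.
    case: hf0 => [E|[h1 _]|[_ h2]]; [lra|lra|].
    by have := g2P _ _ h2 ge; lra.
  exists (q.[f x0 + e] - x0); first by rewrite subr_gt0.
  move=> x; rewrite addrC subrK => xq; rewrite ltNge; apply/negP => h.
  have [gfx hfx] := hf x; have h' := incW _ _ ge gfx h.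
  case: hfx => [E|[_ h1]|[h2 _]]; [lra| |lra].
  by have := g1P _ _ h1 gf0; lra.
have [d2 d20 hd2] : exists2 d, 0 < d & forall x, x0 - d < x -> f x0 - e < f x.
  have [ge|nge] := boolP (in_gap g (f x0 - e)); last first.
    exists 1 => // x _; rewrite ltNge; apply: contra nge => h.
    have [gfx _] := hf x; apply: (in_gap_itv gfx gf0); rewrite h /=; lra.
  have q0 : q.[f x0 - e] < x0.
    have h : q.[f x0 - e] < q.[f x0] by apply: inc => //; lra.
    case: hf0 => [E|[_ h2]|[h1 _]]; [lra| |lra].
    by have := g1P _ _ h2 ge; lra.
  exists (x0 - q.[f x0 - e]); first by rewrite subr_gt0.
  move=> x; rewrite opprB addrC subrK => xq; rewrite ltNge; apply/negP => h.
  have [gfx hfx] := hf x; have h' := incW _ _ gfx ge h.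
  case: hfx => [E|[h2 _]|[_ h1]]; [lra|lra|].
  by have := g2P _ _ h1 gf0; lra.
exists (Num.min d1 d2); first by rewrite /= lt_min d10.
move=> x /=; rewrite lt_min !ltr_distlC => /andP[/andP[_ h1] /andP[h2 _]].
by rewrite hd2 //= hd1.
Qed.

(** Between consecutive critical points [q] is strictly monotone, and [- q] reduces the decreasing
    case to the increasing one. Where the extension is not an inverse, [f x] is a finite end of the
    gap, hence a critical point whose value separates [x] from the range. *)
Lemma poly_branch q g : (1 < size q)%N -> olt g.1 g.2 ->
  (forall d, g.1 = Some d \/ g.2 = Some d -> root q^`() d) ->
  (forall d, root q^`() d -> ~~ inside_gap g d) ->
  exists f : R -> R, [/\ continuous f, forall x, in_gap g (f x),
    forall s, in_gap g s -> f q.[s] = s &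
    forall x, q.[f x] <> x -> exists2 c, root q^`() c &
      (x < q.[c] /\ (forall s, in_gap g s -> q.[c] <= q.[s])) \/
      (q.[c] < x /\ (forall s, in_gap g s -> q.[s] <= q.[c]))].
Proof.
pose mono q := forall x y, in_gap g x -> in_gap g y -> x < y -> q.[x] < q.[y].
wlog pos : q / 0 < q^`().[mido g.1 g.2] => [hw|] sq ltg ends nor.
  have gm := inside_gap_mid ltg.
  have [|pos|/esym z0] := ltgtP 0 q^`().[mido g.1 g.2].
  - by move=> /hw; exact.
  - have [|||||f [cf gf fq hf]] := hw (- q).
    + by rewrite derivN hornerN oppr_gt0.
    + by rewrite size_polyN.
    + by [].
    + by move=> d /ends; rewrite derivN rootN.
    + by move=> d; rewrite derivN rootN; exact: nor.
    exists (fun x => f (- x)); split => //.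
    + apply: (@continuous_comp' _ _ _ (fun x : R => - x) f) => //.
      exact: oppr_continuous.
    + by move=> s gs; rewrite -hornerN fq.
    + move=> x qx; have [|c rc hc] := hf (- x).
        by rewrite hornerN => /oppr_inj.
      exists c; first by move: rc; rewrite derivN rootN.
      case: hc => -[h1 h2]; rewrite hornerN ?ltrN2 in h1; [right|left]; split=> // s gs.
        by have := h2 _ gs; rewrite !hornerN lerN2.
      by have := h2 _ gs; rewrite !hornerN lerN2.
  - by have := nor _ (introT eqP z0); rewrite gm.
have gm := inside_gap_mid ltg.
have inc : mono q.
  move=> x y gx gy xy; rewrite -subr_gt0.
  have [c cxy ->] := polyrcf.poly_mvt q xy; rewrite pmulr_lgt0 ?subr_gt0 //.
  have gc : inside_gap g c.
    move: cxy gx gy; rewrite in_itv /in_gap /inside_gap /= => /andP[xc cy].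
    move=> /andP[h1 _] /andP[_ h2]; apply/andP; split.
      by case: g.1 h1 => //= a h; exact: le_lt_trans xc.
    by case: g.2 h2 => //= a h; exact: lt_le_trans h.
  have nz s : inside_gap g s -> q^`().[s] != 0.
    by move=> gs; apply/negP => /nor; rewrite gs.
  have := IVT_sign_gap (@continuous_horner R q^`()) gm gc nz.
  rewrite [in LHS]ltNge (ltW pos) /= => /esym/negbT; rewrite -leNgt.
  by rewrite le_eqVlt eq_sym (negbTE (nz _ gc)).
have [f [cf gf hf]] := increasing_branch sq ltg inc.
have incW y y' : in_gap g y -> in_gap g y' -> y <= y' -> q.[y] <= q.[y'].
  by move=> gy gy'; rewrite le_eqVlt => /orP[/eqP ->//|/inc h]; exact/ltW/h.
have g1P y s : g.1 = Some y -> in_gap g s -> y <= s by rewrite /in_gap => -> /andP[].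
have g2P y s : g.2 = Some y -> in_gap g s -> s <= y by rewrite /in_gap => -> /andP[].
exists f; split => //.
- move=> s gs; have gfs := gf q.[s].
  case: (hf q.[s]) => [E|[h1 h2]|[h1 h2]].
  + have [sf|fs|//] := ltgtP (f q.[s]) s.
      by have := inc _ _ gfs gs sf; rewrite E ltxx.
    by have := inc _ _ gs gfs fs; rewrite E ltxx.
  + by have := incW _ _ gfs gs (g1P _ _ h2 gs); rewrite leNgt h1.
  + by have := incW _ _ gs gfs (g2P _ _ h2 gs); rewrite leNgt h1.
- move=> x qx; exists (f x).
    apply: ends; case: (hf x) => [//|[_ ->]|[_ ->]]; [left|right] => //.
  case: (hf x) => [//|[h1 h2]|[h1 h2]]; [left|right]; split => // s gs.
    by apply: incW => //; exact: (g1P _ _ h2).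
  by apply: incW => //; exact: (g2P _ _ h2).
Qed.

Definition noncritical q (x : R) := forall c, root q^`() c -> q.[c] <> x.

(* Finitely many continuous partial inverses of [q]; [st] is a strip free of
   critical values, over which a branch is defined everywhere or nowhere. *)
Definition branch_family q (n : nat) (f : nat -> R -> R) :=
  [/\ forall l, (l < n)%N -> continuous (f l),
      forall s, exists2 l, (l < n)%N & f l q.[s] = s,
      forall l st x x', (l < n)%N -> (forall y, inside_gap st y -> noncritical q y) ->
        inside_gap st x -> in_gap st x' -> q.[f l x] = x -> q.[f l x'] = x' &
      forall l st (h : R -> R) x x', (l < n)%N ->
        (forall y, inside_gap st y -> noncritical q y) -> continuous h ->
        (forall y, inside_gap st y -> q.[h y] = y) ->
        inside_gap st x -> inside_gap st x' -> h x = f l x -> h x' = f l x'].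

Lemma poly_branches q : (1 < size q)%N ->
  exists (n : nat) (f : nat -> R -> R), branch_family q n f.
Proof.
move=> sq; have q'0 : q^`() != 0.
  by rewrite -size_poly_gt0 polyorder.size_deriv; case: (size q) sq => [|[]].
have [ds sds hds] := finite_sorted_seq (poly_roots_finite q^`()).
have hds' d : (d \in ds) <-> root q^`() d.
  by rewrite hds /= q'0; split => [[]|].
pose gs := gaps None ds; have ods : opath None ds by [].
pose P g (f : R -> R) := [/\ continuous f, forall x, in_gap g (f x),
    forall s, in_gap g s -> f q.[s] = s &
    forall x, q.[f x] <> x -> exists2 c, root q^`() c &
      (x < q.[c] /\ (forall s, in_gap g s -> q.[c] <= q.[s])) \/
      (q.[c] < x /\ (forall s, in_gap g s -> q.[s] <= q.[c]))].
have gsB g : g \in gs -> [/\ olt g.1 g.2,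
    (forall d, g.1 = Some d \/ g.2 = Some d -> root q^`() d) &
    (forall d, root q^`() d -> ~~ inside_gap g d)].
  move=> /(gaps_bounds ods)[h1 h2 h3 h4]; split => //.
    move=> d [Ed|/h3 Ed]; apply/hds' => //.
    by case: h2 => [|[a ads]]; rewrite Ed // => -[->].
  by move=> d /hds' dds; apply/negP => /andP[]; exact: h4.
have /choice[F hF] : forall g, exists f : R -> R, g \in gs -> P g f.
  move=> g; have [gg|ng] := boolP (g \in gs); last by exists id.
  by have [h1 h2 h3] := gsB _ gg; have [f Pf] := poly_branch sq h1 h2 h3; exists f.
pose g0 : option R * option R := (None, None).
exists (size gs), (fun l => F (nth g0 gs l)).
have PF l : (l < size gs)%N -> P (nth g0 gs l) (F (nth g0 gs l)).
  by move=> hl; apply: hF; exact: mem_nth.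
split.
- by move=> l /PF[].
- move=> s; have [|g [gg h1 h2]] := gaps_locate (A := fun a => a < s) ods.
    by move=> a a' _ _; exact: lt_trans.
  have [_ _ hq _] := hF _ gg.
  exists (index g gs); rewrite ?index_mem ?nth_index //; apply: hq.
  apply/andP; split; first by case: h1 => [->|[a -> /ltW]].
  by case: g.2 h2 => //= a /(_ _ erefl); rewrite -leNgt.
(* An inverse at [x] but not at [x'] would force a critical value between the two, inside the
   strip. *)
- move=> l st x x' /PF[_ gF _ hq] nc sx sx' qx; apply: contrapT => /hq[c rc hc].
  suff : inside_gap st q.[c] by move=> /nc/(_ _ rc).
  case/andP: sx => sx1 sx2; case/andP: sx' => sx1' sx2'.
  case: hc => -[h1 /(_ _ (gF x))]; rewrite qx => h2; apply/andP; split.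
  + by case: st.1 sx1' => //= a h; exact: le_lt_trans h1.
  + by case: st.2 sx2 => //= a h; exact: le_lt_trans h.
  + by case: st.1 sx1 => //= a h; exact: lt_le_trans h2.
  + by case: st.2 sx2' => //= a h; exact: lt_le_trans h.
- move=> l st h x x' hl nc ch qh sx sx' hx; have [_ gF fq _] := PF _ hl.
  have [_ ends _] := gsB _ (mem_nth g0 hl); move: (nth g0 gs l) gF fq ends hx => g gF fq ends hx.
  (* It suffices that [h] stays in the gap. It cannot reach a finite end, which is a critical point,
     because its argument would be a critical value. *)
  suff gh : in_gap g (h x') by have := fq _ gh; rewrite qh // => ->.
  have nend d y : g.1 = Some d \/ g.2 = Some d -> inside_gap st y -> h y - d != 0.
    move=> /ends rd sy; rewrite subr_eq0; apply/eqP => E.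
    by apply: (nc _ sy _ rd); rewrite -E qh.
  have cs d : continuous (fun y => h y - d).
    by apply: continuousB' => //; exact: continuous_cst'.
  have := gF x; rewrite -hx => /andP[gh1 gh2]; apply/andP; split.
    case E : g.1 gh1 => [d|] //= dh; have := IVT_sign_gap (cs d) sx sx'.
    move=> /(_ (fun y => nend d y (or_introl E))).
    by rewrite !subr_lt0 ltNge dh => /esym/negbT; rewrite -leNgt.
  case E : g.2 gh2 => [d|] //= dh; have := IVT_sign_gap (cs d) sx sx'.
  move=> /(_ (fun y => nend d y (or_intror E))).
  have := nend d x (or_intror E) sx; rewrite subr_eq0 => hd.
  by rewrite !subr_lt0 lt_neqAle hd dh => /esym/ltW.
Qed.

End Branches.

(** * Polynomial parametrisation of the boundary curves *)

Section Curves.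
Variables (R : realType) (p : {poly R}) (t : R).

(** The curve is the graph point [(s, p.[s])] rotated by [t], and [param] recovers [s]. *)
Definition curve_x : {poly R} := cos t *: 'X - sin t *: p.
Definition curve_y : {poly R} := sin t *: 'X + cos t *: p.
Definition curve (s : R) : R * R := (curve_x.[s], curve_y.[s]).
Definition param (z : R * R) : R := z.1 * cos t + z.2 * sin t.

Lemma param_curve s : param (curve s) = s.
Proof.
rewrite /param /curve /curve_x /curve_y /= !hornerE.
have := cos2Dsin2 t; set c := cos t; set d := sin t => cd.
rewrite (_ : _ + _ = s * (c ^+ 2 + d ^+ 2)); last by ring.
by rewrite cd mulr1.
Qed.

Lemma Phi_curve s : Phi p t (curve s) = 0.
Proof.
have := param_curve s; rewrite /Phi /param => ->.
rewrite /curve /curve_x /curve_y /= !hornerE.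
have := cos2Dsin2 t; set c := cos t; set d := sin t => cd.
rewrite (_ : - _ * d + _ = p.[s] * (c ^+ 2 + d ^+ 2)); last by ring.
by rewrite cd mulr1 subrr.
Qed.

Lemma curve_param z : Phi p t z = 0 -> curve (param z) = z.
Proof.
move/eqP; rewrite /Phi subr_eq0 => /eqP; rewrite -/(param z) => pz.
rewrite [RHS]surjective_pairing /curve /curve_x /curve_y !hornerE pz /param.
have := cos2Dsin2 t; set c := cos t; set d := sin t => cd.
congr pair.
  by transitivity (z.1 * (c ^+ 2 + d ^+ 2)); [ring|rewrite cd mulr1].
by transitivity (z.2 * (c ^+ 2 + d ^+ 2)); [ring|rewrite cd mulr1].
Qed.

End Curves.

Lemma Phi_curve_poly (R : realType) (p p' : {poly R}) (t t' : R) :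
  exists q : {poly R}, forall s, Phi p' t' (curve p t s) = q.[s].
Proof.
exists (p' \Po (cos t' *: curve_x p t + sin t' *: curve_y p t) -
  (- sin t' *: curve_x p t + cos t' *: curve_y p t)) => s.
rewrite /Phi /curve /=; move: (curve_x p t) (curve_y p t) => cx cy.
by rewrite !hornerE horner_comp !hornerE; congr (_.[_] - _); ring.
Qed.

(** * Arcs of the boundary curves over a strip *)

Section Arcs.
Variables (R : realType) (k : nat) (p : nat -> {poly R}) (t : nat -> R).
Local Notation plane := (R * R)%type.
Local Notation Ph i := (Phi (p i) (t i)).
Local Notation Q i := (curve_x (p i) (t i)).
Local Notation X := (\bigcap_(i in `I_k) poly_half_plane (p i) (t i)).
Implicit Type st : option R * option R.

Definition regular_strip st := [/\ olt st.1 st.2,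
  forall i x, (i < k)%N -> (size (Q i) <= 1)%N -> inside_gap st x -> (Q i).[0] <> x,
  forall i x, (i < k)%N -> (1 < size (Q i))%N -> inside_gap st x ->
    noncritical (Q i) x &
  forall i j s, (i < k)%N -> (j < k)%N -> inside_gap st (Q i).[s] ->
    Ph j (curve (p i) (t i) s) = 0 -> forall s', Ph j (curve (p i) (t i) s') = 0].

(** Arcs are indexed by reals so that the order of the indices is the order of the arcs; in the
    construction the index is the ordinate over the midpoint of the strip. *)
Definition strip_arcs st (ys : seq R) (F : R -> R -> R) :=
  [/\ sorted <%R ys,
      forall y, y \in ys -> continuous (F y) /\
        exists2 i, (i < k)%N & forall x, in_gap st x -> Ph i (x, F y x) = 0,
      forall y y' x, y \in ys -> y' \in ys -> y < y' -> inside_gap st x ->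
        F y x < F y' x &
      forall i z, (i < k)%N -> inside_gap st z.1 -> Ph i z = 0 ->
        exists2 y, y \in ys & z.2 = F y z.1].

Lemma strip_arcs_exist st : regular_strip st -> exists ys F, strip_arcs st ys F.
Proof.
move=> [ltst const crit meet]; pose c := mido st.1 st.2.
have sc : inside_gap st c by exact: inside_gap_mid.
have /choice[nf hnf] : forall i, exists nf : nat * (nat -> R -> R),
    (1 < size (Q i))%N -> branch_family (Q i) nf.1 nf.2.
  move=> i; have [sq|_] := ltnP 1 (size (Q i)); last by exists (0%N, fun _ => id).
  by have [n [f hf]] := poly_branches sq; exists (n, f).
pose n i := (nf i).1; pose f i := (nf i).2.
(* A branch is kept if it is a true inverse over the midpoint; by regularity it is then one over the
   whole closed strip. *)
pose act (e : nat * nat) := (1 < size (Q e.1))%N && ((Q e.1).[f e.1 e.2 c] == c).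
pose es := [seq e <- [seq (i, l) | i <- iota 0 k, l <- iota 0 (n i)] | act e].
pose h (e : nat * nat) x := (curve_y (p e.1) (t e.1)).[f e.1 e.2 x].
have esP e : e \in es -> [/\ (e.1 < k)%N, (e.2 < n e.1)%N, (1 < size (Q e.1))%N &
    (Q e.1).[f e.1 e.2 c] = c].
  rewrite mem_filter => /andP[/andP[sq /eqP Ec] /allpairsPdep[i [l [hi hl E]]]].
  by move: sq Ec; rewrite E /=; move: hi hl; rewrite !mem_iota !add0n.
have esE e : e \in es -> forall x, in_gap st x -> (Q e.1).[f e.1 e.2 x] = x.
  move=> /esP[ek el sq Ec] x sx; have [_ _ b2 _] := hnf _ sq.
  by apply: (b2 _ st c) => // y; exact: crit.
have hcurve e x : e \in es -> in_gap st x ->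
    (x, h e x) = curve (p e.1) (t e.1) (f e.1 e.2 x).
  by move=> ee sx; rewrite /curve esE.
have hcont e : e \in es -> continuous (h e).
  move=> /esP[ek el sq _]; have [b0 _ _ _] := hnf _ sq.
  apply: (@continuous_comp' _ _ _ (f e.1 e.2) (horner (curve_y (p e.1) (t e.1)))).
    exact: b0.
  exact: continuous_horner.
have hzero e x : e \in es -> in_gap st x -> Ph e.1 (x, h e x) = 0.
  by move=> ee sx; rewrite hcurve // Phi_curve.
(* If two arcs meet, the second curve contains the first. Its parameter along the first arc is then
   a continuous inverse of its abscissa, which agrees with the branch that it meets. *)
have heq e e' x0 x : e \in es -> e' \in es -> inside_gap st x0 -> inside_gap st x ->
    h e x0 = h e' x0 -> h e x = h e' x.
  move=> ee ee' sx0 sx E0.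
  have [ek el sq _] := esP _ ee; have [ek' el' sq' _] := esP _ ee'.
  have on' s : Ph e'.1 (curve (p e.1) (t e.1) s) = 0.
    apply: (@meet e.1 e'.1 (f e.1 e.2 x0)) => //.
      by rewrite esE //; exact: inside_gapW.
    by rewrite -hcurve // ?E0 ?hzero //; exact: inside_gapW.
  pose g y := param (t e'.1) (y, h e y).
  have gcurve y : inside_gap st y -> curve (p e'.1) (t e'.1) (g y) = (y, h e y).
    by move=> /inside_gapW sy; apply: curve_param; rewrite hcurve.
  have cg : continuous g.
    apply: continuousD'; apply: continuousM'; try exact: continuous_cst'.
      exact: continuous_id'.
    exact: hcont.
  have [_ _ _ b3] := hnf _ sq'.
  have gx : g x = f e'.1 e'.2 x.
    apply: (b3 e'.2 st g x0 x) => //.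
    - by move=> y; exact: crit.
    - by move=> y sy; have [] := gcurve _ sy.
    - rewrite /g E0 hcurve //; first exact: param_curve.
      exact: inside_gapW.
  by have [_ <-] := gcurve _ sx; rewrite gx.
have hlt e e' x : e \in es -> e' \in es -> inside_gap st x -> h e c < h e' c ->
    h e x < h e' x.
  move=> ee ee' sx ltc; rewrite -subr_lt0.
  rewrite -(@IVT_sign_gap _ (fun x => h e x - h e' x) st c x) ?subr_lt0 //.
    by apply: continuousB'; exact: hcont.
  move=> s ss; rewrite subr_eq0; apply/eqP => E.
  by move: ltc; rewrite (heq e e' s c) // ltxx.
(* By [heq], arcs with equal ordinates over the midpoint coincide over the open strip, so removing
   duplicates loses none. *)
pose vs := [seq h e c | e <- es].
pose ys := sort <=%R (undup vs).
pose pick y := nth (0, 0)%N es (index y vs).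
have pickP y : y \in ys -> pick y \in es /\ h (pick y) c = y.
  rewrite mem_sort mem_undup => yv.
  have hi : (index y vs < size es)%N by rewrite -(size_map (h^~ c) es) index_mem.
  split; first exact: mem_nth.
  by have := nth_index 0 yv; rewrite (nth_map (0, 0)%N).
exists ys, (fun y => h (pick y)); split.
- by rewrite sort_lt_sorted undup_uniq.
- move=> y /pickP[ey _]; split; first exact: hcont.
  exists (pick y).1; first by have [] := esP _ ey.
  by move=> x sx; exact: hzero.
- move=> y y' x /pickP[ey Ey] /pickP[ey' Ey'] yy' sx.
  by apply: hlt => //; rewrite Ey Ey'.
- move=> i z ik sz zi.
  have zc := curve_param zi; set s := param _ _ in zc.
  have Qs : (Q i).[s] = z.1 by rewrite -zc.
  have sq : (1 < size (Q i))%N.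
    rewrite ltnNge; apply/negP => sq; apply: (const _ _ ik sq sz).
    by rewrite -Qs (size1_polyC sq) !hornerC.
  have [_ b1 b2 _] := hnf _ sq.
  have [l ln fl] := b1 s; rewrite Qs in fl.
  have ee : (i, l) \in es.
    rewrite mem_filter; apply/andP; split.
      rewrite /act /= sq /=; apply/eqP.
      apply: (b2 _ st z.1) => //; first by move=> y; exact: crit.
        exact: inside_gapW.
      by rewrite fl.
    by apply/allpairsPdep; exists i, l; rewrite !mem_iota !add0n.
  have hz : h (i, l) z.1 = z.2 by rewrite /h /= /f fl -zc.
  have yin : h (i, l) c \in ys.
    by rewrite mem_sort mem_undup; apply/mapP; exists (i, l).
  exists (h (i, l) c) => //; rewrite -hz.
  have [ey Ey] := pickP _ yin.
  by rewrite (heq (pick (h (i, l) c)) (i, l) c z.1).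
Qed.

Lemma regular_strips_exist : exists2 s : seq R, sorted <%R s &
  forall st, st \in gaps None s -> regular_strip st.
Proof.
have /choice[D hD] : forall ij : nat * nat, exists q : {poly R}, forall s,
    Ph ij.2 (curve (p ij.1) (t ij.1) s) = q.[s].
  by move=> ij; exact: Phi_curve_poly.
(* [(Q i).[0]] is the abscissa of a curve that is a vertical line; for any other curve it adds a
   harmless cut. *)
pose bad : set R := \bigcup_(i in `I_k) ([set (Q i).[0]] `|`
  (horner (Q i) @` [set c | (Q i)^`() != 0 /\ root (Q i)^`() c] `|`
   \bigcup_(j in `I_k) (horner (Q i) @` [set s | D (i, j) != 0 /\ root (D (i, j)) s]))).
have fbad : finite_set bad.
  apply: bigcup_finite => // i _; rewrite !finite_setU; split; first exact: finite_set1.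
  split; first exact/finite_image/poly_roots_finite.
  by apply: bigcup_finite => // j _; exact/finite_image/poly_roots_finite.
have [s ss hs] := finite_sorted_seq fbad; exists s => // st sts.
have [|h1 _ _ h4] := @gaps_bounds _ None s st _ sts; first by [].
have nbad x : inside_gap st x -> ~ bad x.
  by move=> /andP[sx1 sx2] /hs xs; exact: h4 xs sx1 sx2.
split => //.
- by move=> i x ik _ sx E; apply: (nbad _ sx); exists i => //; left.
- move=> i x ik sq sx c rc E; apply: (nbad _ sx); exists i => //; right; left.
  exists c => //; split => //.
  by rewrite -size_poly_gt0 polyorder.size_deriv; case: (size (Q i)) sq => [|[]].
- move=> i j s0 ik jk sx E s'; have := hD (i, j) => /= hq.
  rewrite hq; suff -> : D (i, j) = 0 by rewrite horner0.
  apply/eqP; apply: contrapT => /negP D0.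
  apply: (nbad _ sx); exists i => //; right; right; exists j => //; exists s0 => //.
  by split => //; rewrite /root -hq E.
Qed.

End Arcs.

(** This orders the cells for the sweep: by strip, then by height. *)
Lemma pairwise_allpairs_lex (T U : eqType) (r : rel T) (r' : rel U) (s : seq T)
    (f : T -> seq U) : pairwise r s -> (forall x, x \in s -> pairwise r' (f x)) ->
  pairwise (fun e e' => r e.1 e'.1 || (e.1 == e'.1) && r' e.2 e'.2)
    [seq (x, y) | x <- s, y <- f x].
Proof.
elim: s => //= x s IH /andP[rx ps] pf.
rewrite pairwise_cat; apply/and3P; split.
- apply/allrelP => e e' /mapP[y _ ->] /allpairsPdep[x' [y' [xs' _ ->]]] /=.
  by rewrite (allP rx).
- rewrite pairwise_map; have := pf x (mem_head _ _).
  apply: sub_pairwise => y y' ryy' /=; by rewrite eqxx ryy' orbT.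
- by apply: IH => // x' xs'; apply: pf; rewrite inE xs' orbT.
Qed.

(** * Bands assembled from strips and arcs *)

Section Assembly.
Variables (R : realType) (k : nat) (p : nat -> {poly R}) (t : nat -> R).
Local Notation plane := (R * R)%type.
Local Notation Ph i := (Phi (p i) (t i)).
Local Notation X := (\bigcap_(i in `I_k) poly_half_plane (p i) (t i)).

(** Two points are joined inside the open band by going vertically to the middle curve, along it,
    and vertically again; [Phi] has no zero on the way. *)
Lemma oband_sign (B : band R) i u v : bandwf B ->
  (forall z, oband B z -> Ph i z != 0) -> oband B u -> oband B v ->
  0 < Ph i u -> 0 < Ph i v.
Proof.
move=> wfB nz Bu Bv; have [_ cf cg lt] := wfB.
have path (e : R -> plane) : continuous e ->
    (forall s, 0 <= s <= 1 -> oband B (e s)) -> 0 < Ph i (e 0) -> 0 < Ph i (e 1).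
  move=> ce Be; have ch : continuous (fun s => Ph i (e s)).
    exact: continuous_comp' ce (@Phi_continuous _ _ _).
  have := IVT_sign ch (@ler01 R) (fun s hs => nz _ (Be s hs)).
  have h1 := nz _ (Be 1 (unit_itv1 R)).
  move=> E p0; rewrite lt_neqAle eq_sym h1 leNgt -E -leNgt; exact: ltW.
pose m x := mido (appo (bf B) x) (appo (bg B) x).
have Bm x : ostrip B x -> oband B (x, m x).
  by move=> ox; rewrite /oband /= ox gto_mido ?lto_mido //; exact: lt.
have vert x y y' : oband B (x, y) -> oband B (x, y') ->
    0 < Ph i (x, y) -> 0 < Ph i (x, y').
  move=> /and3P[ox fy gy] /and3P[_ fy' gy'] P0.
  have := path (fun s => (x, y + s * (y' - y))).
  rewrite mul0r addr0 mul1r [y + _]addrC subrK; apply => //.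
    by apply: continuous_pair'; [exact: cst_continuous|exact: continuous_affine].
  move=> s hs; apply/and3P; split => //=.
    by move: fy fy' => /=; case: (bf B) => //= f; exact: convex_gt.
  by move: gy gy' => /=; case: (bg B) => //= f; exact: convex_lt.
have hor x x' : ostrip B x -> ostrip B x' -> 0 < Ph i (x, m x) -> 0 < Ph i (x', m x').
  move=> ox ox' P0; have := path (fun s => (x + s * (x' - x), m (x + s * (x' - x)))).
  rewrite mul0r addr0 mul1r [x + _]addrC subrK; apply => //.
    apply: continuous_pair'; first exact: continuous_affine.
    refine (@continuous_comp' _ _ _ (fun s : R => x + s * (x' - x)) m _ _).
      exact: continuous_affine.
    by apply: continuous_mido => //; exact: continuous_id'.
  move=> s hs; apply: Bm; case/andP: ox ox' => h1 h2 /andP[h3 h4]; apply/andP; split.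
    by case: (ba B) h1 h3 => //= f; exact: convex_gt.
  by case: (bb B) h2 h4 => //= f; exact: convex_lt.
have ou : ostrip B u.1 by case/andP: Bu.
have ov : ostrip B v.1 by case/andP: Bv.
move=> Pu; rewrite [v]surjective_pairing.
apply: (vert _ (m v.1)); [exact: Bm|by rewrite -surjective_pairing|].
apply: (hor u.1) => //.
apply: (vert _ u.2); rewrite -?surjective_pairing //; exact: Bm.
Qed.

Lemma decomposition_exists : exists (N : nat) (b : nat -> band R),
  decomposition k p t N b.
Proof.
have [s ss hs] := @regular_strips_exist R k p t.
have os : opath None s by [].
have /choice[yF hyF] : forall st, exists yF : seq R * (R -> R -> R),
    st \in gaps None s -> strip_arcs k p t st yF.1 yF.2.
  move=> st; have [sts|_] := boolP (st \in gaps None s); last by exists ([::], fun _ => id).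
  by have [ys [F h]] := strip_arcs_exist (hs _ sts); exists (ys, F).
pose ys st := (yF st).1; pose F st := (yF st).2.
pose mk (e : (option R * option R) * (option R * option R)) : band R :=
  Band e.1.1 e.1.2 (omap (F e.1) e.2.1) (omap (F e.1) e.2.2).
pose cells := [seq (st, c) | st <- gaps None s, c <- gaps None (ys st)].
(* Only open cells meeting [X] are kept. Each [Phi] has constant sign on a cell, so these lie
   entirely in [X]. *)
pose idx := [seq e <- cells | `[< oband (mk e) `&` X !=set0 >]].
have cellsP e : e \in cells -> e.1 \in gaps None s /\ e.2 \in gaps None (ys e.1).
  by move=> /allpairsPdep[st [c [h1 h2 ->]]].
have oys st : st \in gaps None s -> opath None (ys st) by move=> /hyF[].
have bnd e : e \in cells -> [/\ olt e.2.1 e.2.2,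
    forall y, e.2.1 = Some y \/ e.2.2 = Some y -> y \in ys e.1 &
    forall y, y \in ys e.1 -> gto e.2.1 y -> lto e.2.2 y -> False].
  move=> /cellsP[h1 /(gaps_bounds (oys _ h1))[g1 g2 g3 g4]]; split => //.
  by move=> y [Ey|/g3//]; case: g2 => [|[a ain]]; rewrite Ey // => -[->].
have wf e : e \in cells -> bandwf (mk e).
  move=> ee; have [h1 _] := cellsP _ ee; have [g1 g2 g3] := bnd _ ee.
  have [_ fc flt _] := hyF _ h1.
  have co o : (forall y, o = Some y -> y \in ys e.1) -> cont_o (omap (F e.1) o).
    by case: o => //= y /(_ _ erefl)/fc[].
  split.
  - exists (mido e.1.1 e.1.2); have [lt _ _ _] := hs _ h1.
    exact: inside_gap_mid.
  - by apply: co => y Ey; apply: g2; left.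
  - by apply: co => y Ey; apply: g2; right.
  - move=> x ox; rewrite /mk /=; case E1 : e.2.1 => [y|] //; case E2 : e.2.2 => [y'|] //=.
    apply: flt => //; [by apply: g2; left|by apply: g2; right|].
    by move: g1; rewrite E1 E2.
have nz e i z : e \in cells -> (i < k)%N -> oband (mk e) z -> Ph i z != 0.
  move=> ee ik /and3P[oz fz gz]; apply/eqP => /esym/esym P0.
  have [h1 _] := cellsP _ ee; have [_ g2 g3] := bnd _ ee.
  have [_ _ flt fall] := hyF _ h1.
  have [y yin zy] := fall _ _ ik oz P0.
  apply: (g3 _ yin).
    move: fz; rewrite /mk /=; case E : e.2.1 => [l|] //=; rewrite zy => lt.
    have lin : l \in ys e.1 by apply: g2; left.
    have [//|yl|E'] := ltgtP l y; last by move: lt; rewrite E' ltxx.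
    by have := lt_trans lt (flt _ _ _ yin lin yl oz); rewrite ltxx.
  move: gz; rewrite /mk /=; case E : e.2.2 => [l|] //=; rewrite zy => lt.
  have lin : l \in ys e.1 by apply: g2; right.
  have [//|ly|E'] := ltgtP y l; last by move: lt; rewrite E' ltxx.
  by have := lt_trans lt (flt _ _ _ lin yin ly oz); rewrite ltxx.
pose e0 : (option R * option R) * (option R * option R) := ((None, None), (None, None)).
have idxP n : (n < size idx)%N -> nth e0 idx n \in cells /\
    oband (mk (nth e0 idx n)) `&` X !=set0.
  move=> hn; have := mem_nth e0 hn; rewrite {1}mem_filter => /andP[/asboolP h ?].
  by [].
exists (size idx), (fun n => mk (nth e0 idx n)).
have wfn n : (n < size idx)%N -> bandwf (mk (nth e0 idx n)).
  by move=> /idxP[ee _]; exact: wf.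
have graph n y : (n < size idx)%N -> y \in ys (nth e0 idx n).1 ->
    on_graph k p t (mk (nth e0 idx n)) (F (nth e0 idx n).1 y).
  move=> /idxP[ee _] yin; have [h1 _] := cellsP _ ee.
  by have [_ fc _ _] := hyF _ h1; have [_ [i ik hi]] := fc _ yin; exists i.
split => //.
- move=> n f hn; have [/bnd[_ g2 _] _] := idxP _ hn; rewrite /mk /=.
  case E : (nth e0 idx n).2.1 => [y|] //= -[<-].
  by apply: graph => //; apply: g2; left.
- move=> n f hn; have [/bnd[_ g2 _] _] := idxP _ hn; rewrite /mk /=.
  case E : (nth e0 idx n).2.2 => [y|] //= -[<-].
  by apply: graph => //; apply: g2; right.
- move=> n /idxP[ee [u [Bu Xu]]] v Bv i ik.
  apply: (oband_sign (wf _ ee) _ Bu Bv (Xu i ik)) => z Bz; exact: (nz (nth e0 idx n)).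
- move=> m n mn hn; have hm := ltn_trans mn hn.
  have pw : pairwise (fun e e' => gap_le e.1 e'.1 || (e.1 == e'.1) && gap_le e.2 e'.2) idx.
    apply: pairwise_filter; apply: pairwise_allpairs_lex; first exact: gaps_pairwise.
    by move=> st /oys; exact: gaps_pairwise.
  have /(pairwiseP e0)/(_ m n hm hn mn) := pw.
  have [em _] := idxP _ hm; have [en _] := idxP _ hn.
  move: (nth e0 idx m) (nth e0 idx n) em en => e e' ee ee' /orP[|/andP[/eqP E1]].
    rewrite /gap_le; case E2 : e.1.2 => [r|] //; case E1 : e'.1.1 => [r'|] // rr'.
    by left; exists r, r'.
  rewrite /gap_le; case E2 : e.2.2 => [y|] //; case E3 : e'.2.1 => [y'|] // yy'.
  right; rewrite /mk /= E1 E2 E3; split => //.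
  exists (F e'.1 y), (F e'.1 y'); split => //.
  have [h1 _] := cellsP _ ee'; have [_ _ flt _] := hyF _ h1.
  have yin : y \in ys e'.1 by have [_ g2 _] := bnd _ ee; rewrite -E1; apply: g2; right.
  have yin' : y' \in ys e'.1 by have [_ g2 _] := bnd _ ee'; apply: g2; left.
  (* Equality occurs for consecutive cells, which share the arc between them. *)
  move: yy'; rewrite le_eqVlt => /orP[/eqP ->|lt]; [by right|left].
  by move=> x ox; apply: flt.
have generic z : X z -> z.1 \notin s -> exists2 n, (n < size idx)%N &
    cband (mk (nth e0 idx n)) z.
  move=> Xz zs; have [|st [sts st1 st2]] := gaps_locate (A := fun a => a < z.1) os.
    by move=> a a' _ _; exact: lt_trans.
  have sz : inside_gap st z.1.
    apply/andP; split; first by case: st1 => [->|[a ->]].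
    have [_ _ g3 _] := gaps_bounds os sts.
    case: st.2 st2 g3 => //= a /(_ _ erefl); rewrite -leNgt => za /(_ _ erefl) ain.
    by rewrite lt_neqAle za andbT; apply: contraNneq zs => ->.
  have [_ fc flt _] := hyF _ sts.
  have [|c [cc c1 c2]] := gaps_locate (A := fun y => F st y z.1 < z.2) (oys _ sts).
    by move=> a a' ain ain' aa'; apply: lt_trans; exact: flt.
  have ec : (st, c) \in cells by apply/allpairsPdep; exists st, c.
  have Bz : oband (mk (st, c)) z.
    apply/and3P; split => //; first by rewrite /mk /=; case: c1 => [->|[a ->]].
    have [_ _ g3 _] := gaps_bounds (oys _ sts) cc.
    rewrite /mk /=; case: c.2 c2 g3 => //= a /(_ _ erefl); rewrite -leNgt => za /(_ _ erefl) ain.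
    rewrite lt_neqAle za andbT; apply/eqP => E.
    have [_ [i ik hi]] := fc _ ain; have := Xz i ik.
    rewrite /poly_half_plane /= [z]surjective_pairing E hi ?ltxx //.
    exact: inside_gapW.
  have ein : (st, c) \in idx.
    by rewrite mem_filter ec andbT; apply/asboolP; exists z.
  exists (index (st, c) idx); rewrite ?index_mem // nth_index //; exact: obandW.
move=> z Xz; have [zs|] := boolP (z.1 \in s); last exact: generic.
(* A point of [X] over a cutting abscissa is a limit of points of [X] slightly to its right, to
   which [generic] applies; the union of the closed bands is closed. *)
pose b n := mk (nth e0 idx n).
have cl : closed (bunion b (size idx)) by exact: closed_bunion.
suff : bunion b (size idx) (z.1 + 0, z.2) by rewrite addr0 -surjective_pairing.
apply: (@closed_curve _ _ _ (fun d : R => (z.1 + d, z.2))) => //.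
  apply: continuous_pair'; last exact: cst_continuous.
  by apply: continuousD'; [exact: continuous_cst'|exact: continuous_id'].
(* Its roots are the members of [s], so isolation of roots provides abscissas near [z.1] outside
   [s]. *)
pose q := \prod_(a <- s) ('X - a%:P).
have q0 : q != 0 by apply: monic_neq0; exact: monic_prod_XsubC.
have n1 := poly_isolated_root z.1 q0.
have n2 : nbhs z.1 [set x | X (x, z.2)].
  have : nbhs z X by apply: open_nbhs_nbhs; split => //; exact: X_open.
  rewrite [z]surjective_pairing.
  have : continuous (fun x : R => (x, z.2)).
    by apply: continuous_pair'; [exact: continuous_id'|exact: cst_continuous].
  by move=> /(_ z.1); apply.
have [d d0 hd] := nbhs_right_exists (filterI n1 n2).
exists d => // x /andP[x0 xd]; have [|[h1 h2] _] := hd x; first by rewrite !ltW.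
apply: generic => //=; apply/negP => xs; apply: h1; first by move=> E; lra.
by apply/eqP; rewrite -[_ == 0]/(root q (z.1 + x)) root_prod_XsubC.
Qed.

End Assembly.

Theorem theorem4p3 (R : realType) (k : nat) (p : nat -> {poly R}) (t : nat -> R) :
  (forall i j, (i < k)%N -> (j < k)%N -> i <> j ->
     poly_half_plane (p i) (t i) <> poly_half_plane (p j) (t j)) ->
  exists (n : nat) (F : nat -> set (R * R)),
    (forall i, (i < n)%N -> region_typeII (F i)) /\
    (forall i j, (i < n)%N -> (j < n)%N -> i <> j -> F i `&` F j = set0) /\
    \bigcap_(i in `I_k) poly_half_plane (p i) (t i) = \bigcup_(i in `I_n) F i.
Proof.
by move=> _; have [N [b decb]] := decomposition_exists k p t;
  exact: decomposition_regions decb.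
Qed.
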